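(* Let $p \geq 3$ be a prime. Let $S \subseteq SL_2(\mathbb{F}_p[t])$ be a finite symmetric subset generating a non-elementary subgroup. Then there exist $C_1, C_2 > 0$ such that for all integers $l \geq 2$, $$\mu_S^{(l)}\big(\{ g \in SL_2(\mathbb{F}_p[t]) : \chi_g \text{ is reducible} \}\big) \leq C_1 e^{-C_2 \sqrt{l/\log(l)}},$$ where $\chi_g \in \mathbb{F}_p[t][X]$ is the characteristic polynomial of $g$ and reducibility is over $\mathbb{F}_p[t]$.
   Context: A subset $S$ of a group is symmetric if $S = S^{-1}$. A subgroup of $SL_2(\mathbb{F}_p[t])$ is non-elementary if it is not virtually soluble. For a finite symmetric subset $S$ of a group $G$, $\mu_S = \frac{1}{|S|}\mathbf{1}_S$ is the uniform probability measure on $S$ ($\mathbf{1}_S$ being the characteristic function of $S$). The convolution of $\phi, \psi$ is $(\phi * \psi)(g) = \sum_{h \in G} \phi(h)\psi(h^{-1}g)$, and convolution powers are defined by $\phi^{(0)} = \mathbf{1}_{\{e\}}$ and $\phi^{(l+1)} = \phi^{(l)} * \phi$. For a measure $\mu$ on $G$ and $X \subseteq G$, $\mu(X) = \sum_{x \in X} \mu(x)$. *)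

(* Defs.v *)
From HB Require Import structures.
From mathcomp Require Import all_boot all_order all_algebra.
From mathcomp Require Import finmap all_classical all_reals all_analysis.

Set Implicit Arguments.
Unset Strict Implicit.
Unset Printing Implicit Defensive.

Import Order.TTheory GRing.Theory Num.Theory.

Local Open Scope classical_set_scope.
Local Open Scope ring_scope.

Record SL (n : nat) (R : comNzRingType) := MkSL {
  SLval :> 'M[R]_n ;
  det_SLval : \det SLval == 1 }.

Section SLGroup.
Variables (n : nat) (R : comNzRingType).
Implicit Types g h : SL n R.

HB.instance Definition _ := [isSub for @SLval n R].
HB.instance Definition _ := [Choice of SL n R by <:].

Fact SLone_subproof : \det (1%:M : 'M[R]_n) == 1.
Proof. by rewrite det1. Qed.

Fact SLmul_subproof g h : \det (g *m h) == 1.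
Proof. by rewrite det_mulmx (eqP (det_SLval g)) (eqP (det_SLval h)) mulr1. Qed.

Fact SLinv_subproof g : \det (\adj g) == 1.
Proof.
have := congr1 determinant (mul_mx_adj g).
by rewrite det_mulmx (eqP (det_SLval g)) mul1r det1 => /eqP.
Qed.

Definition SLone : SL n R := MkSL SLone_subproof.
Definition SLmul g h : SL n R := MkSL (SLmul_subproof g h).
(* the adjugate is the inverse of a matrix of determinant 1 *)
Definition SLinv g : SL n R := MkSL (SLinv_subproof g).

Fact SLmulA : associative SLmul.
Proof. by move=> f g h; apply: val_inj; rewrite /= mulmxA. Qed.

Fact SLmul1 : left_id SLone SLmul.
Proof. by move=> g; apply: val_inj; rewrite /= mul1mx. Qed.

Fact SLmulr1 : right_id SLone SLmul.
Proof. by move=> g; apply: val_inj; rewrite /= mulmx1. Qed.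

Fact SLmulV : left_inverse SLone SLinv SLmul.
Proof.
by move=> g; apply: val_inj; rewrite /= mul_adj_mx (eqP (det_SLval g)).
Qed.

Fact SLmulrV : right_inverse SLone SLinv SLmul.
Proof.
by move=> g; apply: val_inj; rewrite /= mul_mx_adj (eqP (det_SLval g)).
Qed.

HB.instance Definition _ :=
  isGroup.Build (SL n R) SLmulA SLmul1 SLmulr1 SLmulV SLmulrV.

End SLGroup.

Section GroupNotions.
Variable G : groupType.
Local Open Scope group_scope.
Implicit Types (A H K : set G).

Definition is_subgroup H : Prop :=
  [/\ H 1, (forall x y, H x -> H y -> H (x * y)) & (forall x, H x -> H x^-1)].

Definition generated A : set G := smallest is_subgroup A.

Definition derived_subgroup H : set G :=
  generated [set z | exists x y, [/\ H x, H y & z = [~ x, y]]].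

Definition soluble H : Prop :=
  exists n : nat, iter n derived_subgroup H = [set 1].

Definition left_coset (x : G) K : set G := [set x * k | k in K].

Definition finite_index H K : Prop :=
  finite_set [set left_coset x K | x in H].

Definition virtually_soluble H : Prop :=
  exists K, [/\ is_subgroup K, K `<=` H, finite_index H K & soluble K].

Definition non_elementary H : Prop := ~ virtually_soluble H.

Definition symmetric_set A : Prop := A = [set x^-1 | x in A].

End GroupNotions.

Section Convolution.
Variables (R : realType) (G : groupType).
Implicit Types (phi psi mu : G -> R) (X : set G).

Definition uniform_measure (S : {fset G}) : G -> R :=
  fun g => (#|` S|%:R)^-1 * \1_[set` S] g.

(* Sums over G are finitely supported sums (0 when the support is infinite);
   convolution powers of uniform_measure S always have finite support. *)
Definition convolution phi psi : G -> R :=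
  fun g => \sum_(h \in [set: G]) phi h * psi (h^-1 * g)%g.

Definition convolution_power phi (l : nat) : G -> R :=
  iter l (fun psi => convolution psi phi) \1_[set 1%g].

Definition mass mu X : R := \sum_(x \in X) mu x.

End Convolution.

(* Reducible as an element of the ring D: a nonzero product of two nonunits.
   For D = {poly A} this is reducibility over A. *)
Definition reducible (D : idomainType) (f : D) : Prop :=
  f != 0 /\ exists q r : D,
    [/\ q \isn't a GRing.unit, r \isn't a GRing.unit & f = q * r].

(* Main.v *)
Require Import Defs.
From mathcomp Require Import all_boot all_order all_algebra.
From mathcomp Require Import finmap all_classical all_reals all_analysis.
From mathcomp Require Import ring lra zify.

Set Implicit Arguments.
Unset Strict Implicit.
Unset Printing Implicit Defensive.

Import Order.TTheory GRing.Theory Num.Theory.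
Local Open Scope classical_set_scope.
Local Open Scope ring_scope.

(** Write D for the polynomial ring.  The units of D are constants, so a monic
    quadratic X^2 - t X + 1 that factors over D has constant roots, and t is
    constant.  It therefore suffices to show that the walk has constant trace
    with exponentially small probability, which is more than the stated bound.

    Let Gamma be the group generated by S, and let |f| = 2^deg f, the absolute
    value of D at infinity.  Call an element hyperbolic when its trace is not
    constant.

    Algebra ([hyperbolic_pair]).  Gamma contains two hyperbolic elements g1, g2
    without common eigenvector, that is, with det (g1 g2 - g2 g1) <> 0.
    Otherwise Gamma is abelian or fixes a line, hence is soluble, or has only
    constant traces and is finite, or permutes the two eigenlines of a
    hyperbolic element and is virtually abelian.

    Spectral gap ([collision_small]).  A high power h of g1 lengthens every
    vector except those near its contracted eigenline, and similarly for g2 and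
    for the inverses.  As the four lines differ, every nonzero vector is
    lengthened by at least three of the four powers ([stretch_weights]).  This
    ping-pong property, fed into a weighted form of Schur's test on the square
    summable functions on the projective line ([weighted_pairs]), makes the
    probability that two independent walks send a vector to the same line decay
    exponentially.  Hence every event that confines the image of some vector to
    one line is exponentially rare ([one_line_le]); the rest of the proof uses
    only this and the linear growth of degrees along the walk.

    Escape from linear conditions.  By the Cauchy-Schwarz inequality, the
    fourth power of the probability that tr (x y) = t, for independent x and
    y, is at most the probability that tr (x_i y) = t for four independent
    copies x_i of x.  If the x_i are linearly independent, these equations
    determine y, which is a rare event ([trace_bound]).  That the fourth copy
    lies in the span of the others means a condition tr (x m) = 0 with m <> 0;
    the same argument applies to it ([hyperplane_bound]) and leaves the linear
    dependence of three copies, which says that x_1^-1 x_2 and x_1^-1 x_3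
    commute ([dependent3_comm]).  A centralizer either fixes a line, a rare
    event, or is the unit group of a quadratic order, which has so few elements
    of bounded height that a union bound suffices ([centralizer_bound]). *)

(** * Two-by-two matrices acting on the plane *)

Section PlaneRing.
Variable D : comNzRingType.
Implicit Types (g h m : 'M[D]_2) (u v : D * D).

(** Reduce an equation to a ring identity by exhibiting it as a linear
    combination of hypotheses. *)
Lemma lincomb1 (k a b c d : D) : a = b -> c - d = k * (a - b) -> c = d.
Proof. by move=> -> /eqP; rewrite subrr mulr0 subr_eq0 => /eqP. Qed.

Lemma lincomb2 (k k' a b a' b' c d : D) : a = b -> a' = b' ->
  c - d = k * (a - b) + k' * (a' - b') -> c = d.
Proof. by move=> -> e; rewrite subrr mulr0 add0r; apply: lincomb1 e. Qed.

Lemma lift00 : lift ord0 ord0 = 1 :> 'I_2.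
Proof. exact/val_inj. Qed.

Lemma ord2P (P : 'I_2 -> Prop) : P 0 -> P 1 -> forall i, P i.
Proof.
move=> P0 P1 [[|[|//]] lt_i].
- by rewrite (_ : Ordinal _ = 0) //; apply/val_inj.
- by rewrite (_ : Ordinal _ = 1) //; apply/val_inj.
Qed.

Lemma mx2P g h : g 0 0 = h 0 0 -> g 0 1 = h 0 1 -> g 1 0 = h 1 0 ->
  g 1 1 = h 1 1 -> g = h.
Proof. by move=> *; apply/matrixP; apply: ord2P; apply: ord2P. Qed.

Lemma mulmx2E g h i j : (g *m h) i j = g i 0 * h 0 j + g i 1 * h 1 j.
Proof. by rewrite !mxE !big_ord_recl big_ord0 addr0 lift00. Qed.

Lemma submx2E g h i j : (g - h) i j = g i j - h i j.
Proof. by rewrite !mxE. Qed.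

Lemma mxtrace2E g : \tr g = g 0 0 + g 1 1.
Proof. by rewrite /mxtrace !big_ord_recl big_ord0 addr0 lift00. Qed.

Lemma det2E g : \det g = g 0 0 * g 1 1 - g 0 1 * g 1 0.
Proof.
rewrite (expand_det_row _ 0) !big_ord_recl big_ord0 addr0 lift00.
rewrite /cofactor !det_mx11 !mxE /= ?lift00 expr0 mul1r expr1 mulN1r mulrN.
by congr (_ * _ - _ * _); congr (g _ _); apply/val_inj.
Qed.

Lemma adj2E g : \adj g = (\tr g)%:M - g.
Proof.
apply: mx2P; rewrite !mxE /cofactor det_mx11 !mxE mxtrace2E /= ?mulr1n ?mulr0n.
- rewrite mul1r addrC addKr; congr (g _ _); exact/val_inj.
- rewrite mulN1r sub0r; congr (- g _ _); exact/val_inj.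
- rewrite mulN1r sub0r; congr (- g _ _); exact/val_inj.
- rewrite expr2 mulrNN !mul1r addrK; congr (g _ _); exact/val_inj.
Qed.

Definition app g v : D * D :=
  (g 0 0 * v.1 + g 0 1 * v.2, g 1 0 * v.1 + g 1 1 * v.2).

Definition vcoord (i : bool) v : D := if i then v.1 else v.2.

Definition wedge u v : D := u.1 * v.2 - u.2 * v.1.

Lemma app_mul g h v : app (g *m h) v = app g (app h v).
Proof. by rewrite /app !mulmx2E /=; congr (_, _); ring. Qed.

Lemma app1 v : app 1%:M v = v.
Proof.
by case: v => a b; rewrite /app !mxE /= !mulr1n !mulr0n; congr (_, _); ring.
Qed.

Lemma wedge_app g u v : wedge (app g u) (app g v) = \det g * wedge u v.
Proof. by rewrite det2E /wedge /=; ring. Qed.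

Lemma wedgeC u v : wedge u v = - wedge v u.
Proof. by rewrite /wedge; ring. Qed.

Lemma wedgevv u : wedge u u = 0.
Proof. by rewrite /wedge; ring. Qed.

(** The polarised form of [wedge_app]. *)
Lemma wedge_trace h u v :
  wedge (app h u) v + wedge u (app h v) = \tr h * wedge u v.
Proof. by rewrite mxtrace2E /wedge /=; ring. Qed.

End PlaneRing.
Arguments lincomb1 {D} k {a b c d}.
Arguments lincomb2 {D} k k' {a b a' b' c d}.

Section PlaneDomain.
Variable D : idomainType.
Implicit Types (a g h m x y z : 'M[D]_2) (u v w : D * D).

Lemma vec_neq0 v : v != 0 -> v.1 != 0 \/ v.2 != 0.
Proof.
case: v => a b; rewrite -[_ == _]/((a == 0) && (b == 0)) negb_and.
by move/orP.
Qed.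

Lemma e1_neq0 : (1, 0) != 0 :> D * D.
Proof. by rewrite -[_ == _]/((1 == 0) && (0 == 0)) oner_eq0. Qed.

Lemma mulf_eq0l (c d : D) : c != 0 -> c * d = 0 -> d = 0.
Proof. by move=> c0 /eqP; rewrite mulf_eq0 (negPf c0) => /eqP. Qed.

Lemma wedge_trans v u w : v != 0 -> wedge u v = 0 -> wedge v w = 0 ->
  wedge u w = 0.
Proof.
move=> v0 uv vw; case: (vec_neq0 v0) => vi0; apply: (mulf_eq0l vi0).
- by transitivity (w.1 * wedge u v + u.1 * wedge v w);
    [rewrite /wedge; ring | rewrite uv vw !mulr0 addr0].
- by transitivity (w.2 * wedge u v + u.2 * wedge v w);
    [rewrite /wedge; ring | rewrite uv vw !mulr0 addr0].
Qed.

Lemma mx2_neq0 m : m != 0 -> exists i j, m i j != 0.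
Proof.
case: (boolP [exists i, [exists j, m i j != 0]]).
  by move=> /existsP[i /existsP[j mij]] _; exists i, j.
move=> /existsPn m0 /eqP[]; apply/matrixP => i j; rewrite mxE; apply/eqP.
by have /existsPn/(_ j) := m0 i; rewrite negbK.
Qed.

Lemma app_row0 m v i : app m v = 0 -> m i 0 * v.1 + m i 1 * v.2 = 0.
Proof. by case=> mv0 mv1; move: i; apply: ord2P. Qed.

Lemma kernel_line m u v : m != 0 -> app m u = 0 -> app m v = 0 -> wedge u v = 0.
Proof.
move=> /mx2_neq0[i [j mij]] /(app_row0 i) mu /(app_row0 i) mv.
move: j mij; apply: ord2P => mij; apply: (mulf_eq0l mij).
- transitivity ((m i 0 * u.1 + m i 1 * u.2) * v.2 -
    (m i 0 * v.1 + m i 1 * v.2) * u.2); first by rewrite /wedge; ring.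
  by rewrite mu mv !mul0r subr0.
- transitivity (- (m i 0 * u.1 + m i 1 * u.2) * v.1 +
    (m i 0 * v.1 + m i 1 * v.2) * u.1); first by rewrite /wedge; ring.
  by rewrite mu mv oppr0 !mul0r addr0.
Qed.

Lemma row_perp m i : \det m = 0 -> app m (- m i 1, m i 0) = 0.
Proof.
rewrite det2E => dm; congr (_, _) => /=; move: i; apply: ord2P; try ring.
- by rewrite -[RHS]oppr0 -dm; ring.
- by rewrite -[RHS]dm; ring.
Qed.

Lemma vecN_neq0 (b c : D) : (b != 0) || (c != 0) -> (- b, c) != 0 :> D * D.
Proof.
by rewrite -[(_, _) == _]/((- b == 0) && (c == 0)) oppr_eq0 negb_and.
Qed.

Lemma singular_kernel m : \det m = 0 -> exists2 v, v != 0 & app m v = 0.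
Proof.
have [->|/mx2_neq0[i [j mij]]] := eqVneq m 0.
  exists (1, 0); last by rewrite /app !mxE /=; congr (_, _); ring.
  exact: e1_neq0.
move=> dm; exists (- m i 1, m i 0); last exact: row_perp.
by apply: vecN_neq0; move: j mij; apply: ord2P => ->; rewrite ?orbT.
Qed.

Lemma cayley2 g : g *m g = \tr g *: g - (\det g)%:M.
Proof.
by apply: mx2P; rewrite mulmx2E !mxE mxtrace2E det2E ?mulr1n ?mulr0n; ring.
Qed.

(** The characteristic polynomial of [g] is irreducible over the fraction
    field. *)
Definition no_eigenline g := forall v, wedge v (app g v) = 0 -> v = 0.

Lemma app_adj g v : app (\adj g) v =
  (\tr g * v.1 - (app g v).1, \tr g * v.2 - (app g v).2).
Proof. by rewrite adj2E /app !mxE mulr1n mulr0n; congr (_, _) => /=; ring. Qed.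

Lemma app_comm g h v : g *m h = h *m g -> app g (app h v) = app h (app g v).
Proof. by move=> gh; rewrite -!app_mul gh. Qed.

Lemma app0 g : app g 0 = 0.
Proof. by rewrite /app /= !mulr0 addr0. Qed.

(** The kernel of an element of the centralizer of [a] is [a]-invariant, hence
    trivial when [a] fixes no line. *)
Lemma centralizer_domain a y : no_eigenline a -> y *m a = a *m y ->
  \det y = 0 -> y = 0.
Proof.
move=> na ya /singular_kernel[v v0 yv]; apply/eqP; apply: contraNT v0 => y0.
by apply/eqP/na; apply: (kernel_line y0) => //; rewrite (app_comm _ ya) yv app0.
Qed.

Lemma mulmx_det_eq0 y z : \det y != 0 -> y *m z = 0 -> z = 0.
Proof.
move=> dy yz; have := mulmxA (\adj y) y z.
rewrite yz mulmx0 mul_adj_mx mul_scalar_mx => /esym /matrixP dz.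
by apply/matrixP => i j; have := dz i j; rewrite !mxE => /(mulf_eq0l dy).
Qed.

(** If [gh - hg] is singular and nonzero then its kernel is a line fixed by
    [g]. *)
Lemma no_eigenline_comm g h : \det g = 1 -> no_eigenline g ->
  \det (g *m h - h *m g) = 0 -> g *m h = h *m g.
Proof.
move=> dg ng dC; apply/eqP; rewrite -subr_eq0; apply/eqP.
set C := _ - _ in dC *.
have gC : C *m \adj g = g *m C.
  rewrite /C adj2E !mulmxBl !mulmxBr; apply: mx2P;
    by rewrite !(mulmx2E, mxE) mxtrace2E ?mulr1n ?mulr0n; ring.
have [v v0 Cv] := singular_kernel dC; apply/eqP; apply: contraNT v0 => C0.
apply/eqP/ng; have : wedge v (app (\adj g) v) = 0.
  by apply: (kernel_line C0) => //; rewrite -app_mul gC app_mul Cv app0.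
rewrite app_adj /wedge /= => w0.
rewrite -[RHS]oppr0 -w0; ring.
Qed.

(** Proportionality over the fraction field, expressed by minors; it holds
    trivially if one of the matrices vanishes. *)
Definition parallel m m' := forall i j k l, m i j * m' k l = m k l * m' i j.

(** Commuting means that the traceless parts are proportional. *)
Lemma comm_entries a y : y *m a = a *m y ->
  [/\ y 0 1 * a 1 0 = y 1 0 * a 0 1,
      (y 0 0 - y 1 1) * a 0 1 = y 0 1 * (a 0 0 - a 1 1) &
      (y 0 0 - y 1 1) * a 1 0 = y 1 0 * (a 0 0 - a 1 1)].
Proof.
move=> ya; have e i j : (y *m a) i j = (a *m y) i j by rewrite ya.
have := e 0 0; have := e 0 1; have := e 1 0; rewrite !mulmx2E => e10 e01 e00.
split.
- by apply: (addrI (y 0 0 * a 0 0)); rewrite e00; ring.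
- apply/eqP; rewrite -subr_eq0; apply/eqP.
  by move/eqP: e01; rewrite -subr_eq0 => /eqP <-; ring.
- apply/eqP; rewrite -subr_eq0; apply/eqP; rewrite -[RHS]oppr0.
  by move/eqP: e10; rewrite -subr_eq0 => /eqP <-; ring.
Qed.

Lemma nonscalar_entry a : a != (a 0 0)%:M ->
  [\/ a 0 1 != 0, a 1 0 != 0 | a 0 0 - a 1 1 != 0].
Proof.
move=> na; have [a01|] := eqVneq (a 0 1) 0; last by constructor 1.
have [a10|] := eqVneq (a 1 0) 0; last by constructor 2.
constructor 3; apply: contraNneq na => /subr0_eq a11.
by apply/eqP/mx2P; rewrite !mxE ?mulr1n ?mulr0n.
Qed.

Lemma cross_cancel (c ai aj yk yi yj zk zi zj : D) : c != 0 ->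
  yi * c = yk * ai -> yj * c = yk * aj ->
  zi * c = zk * ai -> zj * c = zk * aj -> yi * zj = yj * zi.
Proof.
move=> c0 yic yjc zic zjc; apply: (mulIf (mulf_neq0 c0 c0)).
by rewrite !(mulrACA _ _ c c) yic yjc zic zjc !mulrA; ring.
Qed.

Lemma centralizer_comm a y z : a != (a 0 0)%:M ->
  y *m a = a *m y -> z *m a = a *m z -> y *m z = z *m y.
Proof.
move=> /nonscalar_entry na /comm_entries[y1 y2 y3] /comm_entries[z1 z2 z3].
suff [e1 e2 e3] : [/\ y 0 1 * z 1 0 = y 1 0 * z 0 1,
  (y 0 0 - y 1 1) * z 0 1 = y 0 1 * (z 0 0 - z 1 1) &
  (y 0 0 - y 1 1) * z 1 0 = y 1 0 * (z 0 0 - z 1 1)].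
  apply: mx2P; rewrite !mulmx2E; [apply: (lincomb1 1 e1) | apply: (lincomb1 1 e2) |
    apply: (lincomb1 (-1) e3) | apply: (lincomb1 (-1) e1)]; ring.
case: na => na; split.
- exact: (cross_cancel na (erefl _) (esym y1) (erefl _) (esym z1)).
- exact: (cross_cancel na y2 (erefl _) z2 (erefl _)).
- exact: (cross_cancel na y2 (esym y1) z2 (esym z1)).
- exact: (cross_cancel na y1 (erefl _) z1 (erefl _)).
- exact: (cross_cancel na y3 y1 z3 z1).
- exact: (cross_cancel na y3 (erefl _) z3 (erefl _)).
- exact: (cross_cancel na (esym y2) (esym y3) (esym z2) (esym z3)).
- exact: (cross_cancel na (erefl _) (esym y2) (erefl _) (esym z2)).
- exact: (cross_cancel na (erefl _) (esym y3) (erefl _) (esym z3)).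
Qed.

Lemma no_eigenline_nonscalar a : no_eigenline a -> a != (a 0 0)%:M.
Proof.
move=> na; apply/eqP => a_s; have /eqP := e1_neq0; apply.
by apply: na; rewrite a_s /wedge /app /= !mxE ?mulr1n ?mulr0n; ring.
Qed.

(** Two elements of the centralizer with the same trace are roots of the same
    quadratic polynomial, and the centralizer has no zero divisors. *)
Lemma centralizer_trace a y z : no_eigenline a -> \det y = 1 -> \det z = 1 ->
  y *m a = a *m y -> z *m a = a *m z -> \tr y = \tr z -> y = z \/ y = \adj z.
Proof.
move=> na dy dz ya za tyz.
have yz := centralizer_comm (no_eigenline_nonscalar na) ya za.
have [/eqP|d0] := eqVneq (\det (y - z)) 0.
  move=> /eqP/(centralizer_domain na) yz0; left; apply/subr0_eq/yz0.
  by rewrite mulmxBl mulmxBr ya za.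
right; apply/subr0_eq; apply: (mulmx_det_eq0 d0).
rewrite mulmxBr !mulmxBl cayley2 mul_mx_adj dy dz tyz adj2E mulmxBr yz.
rewrite mul_mx_scalar; apply/matrixP => i j.
by rewrite !mxE; ring.
Qed.

(** The eigenspaces of a nonscalar matrix are lines. *)
Lemma eigenline_centralizer a z v : a != (a 0 0)%:M -> z *m a = a *m z ->
  v != 0 -> wedge v (app a v) = 0 -> wedge v (app z v) = 0.
Proof.
move=> a_ns za v0 va.
(* the matrix [v_i a - (a v)_i] kills [v] and commutes with [z] *)
have key (c d : D) : c != 0 -> app (c *: a - d%:M) v = 0 ->
    wedge v (app z v) = 0.
  move=> c0 kv; apply: (@kernel_line (c *: a - d%:M)) => //.
    apply: contraNneq a_ns => /matrixP e; apply/eqP/mx2P;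
      rewrite !mxE ?mulr1n ?mulr0n.
    - by [].
    - by have := e 0 1; rewrite !mxE mulr0n subr0 => /(mulf_eq0l c0).
    - by have := e 1 0; rewrite !mxE mulr0n subr0 => /(mulf_eq0l c0).
    - have := e 0 0; have := e 1 1.
      rewrite !mxE mulr1n => /subr0_eq e1 /subr0_eq e0.
      by apply: (mulfI c0); rewrite e1 e0.
  rewrite -app_mul mulmxBl -scalemxAl -za -scalar_mxC scalemxAr -mulmxBr.
  rewrite app_mul kv.
  exact: app0.
have va' := va; rewrite /wedge /app /= in va'.
case: (vec_neq0 v0) => vi0.
- apply: (key _ (app a v).1 vi0); rewrite /app !mxE ?mulr1n ?mulr0n /=.
  congr (_, _); first by ring.
  by apply: (lincomb1 1 va'); ring.
- apply: (key _ (app a v).2 vi0); rewrite /app !mxE ?mulr1n ?mulr0n /=.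
  congr (_, _); last by ring.
  by apply: (lincomb1 (-1) va'); ring.
Qed.

Lemma trace0_entry m : \tr m = 0 -> m 1 1 = - m 0 0.
Proof. by rewrite mxtrace2E addrC => /eqP; rewrite addr_eq0 => /eqP. Qed.

Lemma traceless_parallel m n : \tr m = 0 -> \tr n = 0 ->
  m 0 0 * n 0 1 = m 0 1 * n 0 0 -> m 0 0 * n 1 0 = m 1 0 * n 0 0 ->
  m 0 1 * n 1 0 = m 1 0 * n 0 1 -> parallel m n.
Proof.
move=> /trace0_entry m1 /trace0_entry n1 e1 e2 e3 i j k l.
by move: i j k l; do 4 apply: ord2P;
   rewrite ?m1 ?n1 ?mulrN ?mulNr ?e1 ?e2 ?e3.
Qed.

(** On traceless matrices the commutator is, up to a factor, the cross product
    for the trace form, so whatever is orthogonal to [a] and [b] is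
    proportional to it. *)
Lemma orth_commutator a b m : \tr m = 0 -> \tr (a *m m) = 0 ->
  \tr (b *m m) = 0 -> parallel m (a *m b - b *m a).
Proof.
move=> tm; have m1 := trace0_entry tm; rewrite !mxtrace2E !mulmx2E m1 => ta tb.
apply: traceless_parallel => //; rewrite ?mxtrace2E !submx2E !mulmx2E.
- by ring.
- by apply: (lincomb2 (b 0 1) (- a 0 1) ta tb); ring.
- by apply: (lincomb2 (- b 1 0) (a 1 0) ta tb); ring.
- by apply: (lincomb2 (b 0 0 - b 1 1) (a 1 1 - a 0 0) ta tb); ring.
Qed.

Lemma parallel_trans m n c : c != 0 -> parallel m c -> parallel n c ->
  parallel m n.
Proof.
move=> /mx2_neq0[k [l ckl]] mc nc i j s t.
exact: (cross_cancel ckl (mc i j k l) (mc s t k l) (nc i j k l) (nc s t k l)).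
Qed.

Lemma parallel_mulr m n x : parallel m n -> parallel (m *m x) (n *m x).
Proof.
move=> mn i j k l; rewrite !mulmx2E !mulrDl !mulrDr !(mulrACA _ (x _ _)).
by rewrite !(mn i _ k _) !addrA; ring.
Qed.

Lemma parallel_scale m n : parallel m n -> m != 0 -> exists k l,
  m k l != 0 /\ m k l *: n = n k l *: m.
Proof.
move=> mn /mx2_neq0[k [l mkl]]; exists k, l; split=> //.
by apply/matrixP => i j; rewrite !mxE mn mulrC.
Qed.

(** Three group elements that are orthogonal to a plane of matrices are
    linearly dependent; translating the first one to the identity turns linear
    dependence into commutation. *)
Lemma orth_plane_comm x a b m n : \det x = 1 -> ~ parallel m n ->
  \tr (x *m m) = 0 -> \tr (x *m a *m m) = 0 -> \tr (x *m b *m m) = 0 ->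
  \tr (x *m n) = 0 -> \tr (x *m a *m n) = 0 -> \tr (x *m b *m n) = 0 ->
  a *m b = b *m a.
Proof.
move=> dx mn t1 t2 t3 t4 t5 t6; apply/subr0_eq.
case: (eqVneq (a *m b - b *m a) 0) => // C0; case: mn.
rewrite -[m]mulmx1 -[n]mulmx1.
have <- : x *m \adj x = 1%:M by rewrite mul_mx_adj dx.
rewrite !mulmxA; apply/parallel_mulr/(parallel_trans C0); apply: orth_commutator;
  by rewrite ?mulmxA mxtrace_mulC ?mulmxA.
Qed.

(** When [x] and [y] have no common eigenvector, 1, x, y and x y form a basis
    of the matrix algebra, and the trace form is nondegenerate. *)
Lemma trace_form_inj x y z : \det (x *m y - y *m x) != 0 ->
  \tr z = 0 -> \tr (x *m z) = 0 -> \tr (y *m z) = 0 -> \tr (x *m y *m z) = 0 ->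
  z = 0.
Proof.
move=> dC t1 tx ty txy; have zC := orth_commutator t1 tx ty.
set C := x *m y - y *m x in dC zC.
apply/matrixP => i j; rewrite [RHS]mxE; apply: (mulIf dC); rewrite mul0r.
(* [z] is proportional to [C], and [tr (x y C) = - det C] *)
have <- : z i j * - \tr (x *m y *m C) = z i j * \det C.
  congr (_ * _); rewrite /C mxtrace2E det2E !(mulmx2E, submx2E) ; ring.
rewrite mxtrace2E !mulmx2E.
rewrite [in LHS](_ : - _ = - (x *m y) 0 0 * C 0 0 - (x *m y) 0 1 * C 1 0
  - (x *m y) 1 0 * C 0 1 - (x *m y) 1 1 * C 1 1);
  last by rewrite !mulmx2E; ring.
rewrite !mulrDr !mulrN !(mulrCA (z i j)) !(zC i j).
have {}txy : \sum_(k < 2) \sum_(l < 2) (x *m y) k l * z l k = 0.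
  by rewrite -[RHS]txy /mxtrace; apply: eq_bigr => k _; rewrite [RHS]mxE.
by move: txy; rewrite !big_ord_recl !big_ord0 !addr0 !lift00 => txy;
   apply: (lincomb1 (- C i j) txy); ring.
Qed.

(** Fricke's identity, in homogeneous form. *)
Lemma fricke x y : \det (x *m y - y *m x) = 4 * \det x * \det y -
  \det y * \tr x ^+ 2 - \det x * \tr y ^+ 2 - \tr (x *m y) ^+ 2 +
  \tr x * \tr y * \tr (x *m y).
Proof. by rewrite !det2E !mxtrace2E !submx2E !mulmx2E; ring. Qed.

(** Up to a factor a singular [m] is the product of a column u and a row r, so
    that [tr (w m)] is r (w u); its vanishing puts [w u] on the line orthogonal
    to r. *)
Lemma singular_trace m (w : 'M[D]_2) i j : \det m = 0 -> \tr (w *m m) = 0 ->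
  wedge (- m i 1, m i 0) (app w (m 0 j, m 1 j)) = 0.
Proof.
rewrite det2E mxtrace2E !mulmx2E => dm t0.
move: i j; do 2 apply: ord2P; rewrite /wedge /=.
- apply: (lincomb2 (- m 0 0) (w 1 1) t0 dm); ring.
- apply: (lincomb2 (- m 0 1) (- w 0 1) t0 dm); ring.
- apply: (lincomb2 (- m 1 0) (- w 1 0) t0 dm); ring.
- apply: (lincomb2 (- m 1 1) (w 0 0) t0 dm); ring.
Qed.

End PlaneDomain.

(** * Heights of vectors over a polynomial ring *)

Section DegreeNorm.
Variable F : fieldType.
Implicit Types (a c : {poly F}) (b g h m : 'M[{poly F}]_2).
Implicit Types (v u : {poly F} * {poly F}).

(** The absolute value at infinity, with values in the natural numbers; the
    value 0 at 0 makes it multiplicative and ultrametric without exceptions. *)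
Definition nrm a : nat := if a == 0 then 0%N else (2 ^ (size a).-1)%N.

Lemma nrm0 : nrm 0 = 0%N. Proof. by rewrite /nrm eqxx. Qed.

Lemma nrm_gt0 a : (0 < nrm a)%N = (a != 0).
Proof. by rewrite /nrm; case: eqP => //= _; rewrite expn_gt0. Qed.

Lemma nrmN a : nrm (- a) = nrm a.
Proof. by rewrite /nrm oppr_eq0 size_polyN. Qed.

Lemma nrmM a c : nrm (a * c) = (nrm a * nrm c)%N.
Proof.
rewrite /nrm mulf_eq0; case: eqP => [//|/eqP a0]; case: eqP => [|/eqP c0] /=.
  by rewrite muln0.
rewrite size_mul // -expnD; congr (2 ^ _)%N.
have := size_poly_gt0 a; have := size_poly_gt0 c; rewrite a0 c0.
by case: (size a) (size c) => [|k] [|l] // _ _; rewrite addSn addnS.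
Qed.

Lemma nrm_le_size a n : (size a <= n.+1)%N -> (nrm a <= 2 ^ n)%N.
Proof.
rewrite /nrm; case: eqP => // _ an; rewrite leq_exp2l //; lia.
Qed.

Lemma size_le_nrm a n : (nrm a <= 2 ^ n)%N -> (size a <= n.+1)%N.
Proof.
rewrite /nrm; case: eqP => [->|_]; first by rewrite size_poly0.
by rewrite leq_exp2l //; lia.
Qed.

Lemma nrmD_le a c k : (nrm a <= k)%N -> (nrm c <= k)%N -> (nrm (a + c) <= k)%N.
Proof.
have [->|a0] := eqVneq a 0; first by rewrite add0r.
have [->|c0] := eqVneq c 0; first by rewrite addr0.
move=> ak ck; apply: leq_trans (_ : maxn (nrm a) (nrm c) <= k)%N; last first.
  by rewrite geq_max ak.
rewrite /nrm (negPf a0) (negPf c0); case: eqP => // ac0.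
by rewrite leq_max !leq_exp2l //; have := size_polyD a c; lia.
Qed.

Lemma nrmB_le a c k : (nrm a <= k)%N -> (nrm c <= k)%N -> (nrm (a - c) <= k)%N.
Proof. by move=> ak ck; rewrite nrmD_le ?nrmN. Qed.

Lemma nrmM_le a c k l : (nrm a <= k)%N -> (nrm c <= l)%N ->
  (nrm (a * c) <= k * l)%N.
Proof. by rewrite nrmM; apply: leq_mul. Qed.

Lemma nrmD_eq a c : (nrm c < nrm a)%N -> nrm (a + c) = nrm a.
Proof.
have [->|a0] := eqVneq a 0; first by rewrite nrm0.
have [->|c0] := eqVneq c 0; first by rewrite addr0.
move=> ca; suff sca : (size c < size a)%N.
  have ac0 : a + c != 0.
    by rewrite -size_poly_gt0 size_polyDl //; apply: leq_trans sca.
  by rewrite /nrm (negPf a0) (negPf ac0) size_polyDl.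
move: ca; rewrite /nrm (negPf a0) (negPf c0) ltn_exp2l //.
by case: (size a) (size c) => [|k] [|l].
Qed.

Definition vnrm v := maxn (nrm v.1) (nrm v.2).

Lemma vnrm_gt0 v : v != 0 -> (0 < vnrm v)%N.
Proof.
by move/vec_neq0; rewrite /vnrm leq_max !nrm_gt0 => -[]->; rewrite ?orbT.
Qed.

Lemma nrm_coord v : (nrm v.1 <= vnrm v)%N /\ (nrm v.2 <= vnrm v)%N.
Proof. by rewrite !leq_max !leqnn orbT. Qed.

Definition mx_bounded g K := forall i j, (nrm (g i j) <= K)%N.

Lemma app_coord_le g K v k : mx_bounded g K -> (vnrm v <= k)%N ->
  (nrm (app g v).1 <= K * k)%N /\ (nrm (app g v).2 <= K * k)%N.
Proof.
move=> gK vk; have [v1 v2] := nrm_coord v.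
by split; apply: nrmD_le; apply: nrmM_le => //; apply: leq_trans vk.
Qed.

Lemma vnrm_app g K v k : mx_bounded g K -> (vnrm v <= k)%N ->
  (vnrm (app g v) <= K * k)%N.
Proof. by move=> gK /(app_coord_le gK)[]; rewrite geq_max => -> ->. Qed.

Lemma nrm_wedge u v k l : (vnrm u <= k)%N -> (vnrm v <= l)%N ->
  (nrm (wedge u v) <= k * l)%N.
Proof.
by rewrite !geq_max => /andP[? ?] /andP[? ?]; apply: nrmB_le; apply: nrmM_le.
Qed.

Lemma vnrm_attained v : nrm v.1 = vnrm v \/ nrm v.2 = vnrm v.
Proof.
by rewrite /vnrm; case: leqP; [right | left].
Qed.

(** Descent on the height: along a line fixed by [g] the heights of [g v], [v]
    and [g^-1 v] are in geometric progression, so one of [g v] and [g^-1 v] is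
    smaller than [v] unless all three have the same height; in that case
    [(tr g) v = g v + g^-1 v] is no longer than [v]. *)
Lemma fixed_line_trace g v : \det g = 1 -> v != 0 -> wedge v (app g v) = 0 ->
  (size (\tr g) <= 1)%N.
Proof.
have [n] := ubnP (vnrm v); elim: n => // n IH in g v *.
rewrite ltnS => vn dg v0 vg.
have app_neq0 h : \det h = 1 -> app h v != 0.
  move=> dh; apply: contraNneq v0 => hv; apply/eqP.
  by rewrite -[LHS]app1 -dh -mul_adj_mx app_mul hv app0.
have [lt1|ge1] := ltnP (vnrm (app g v)) (vnrm v).
  apply: (IH g (app g v)) => //; first exact: leq_trans lt1 vn.
    exact: app_neq0.
  by rewrite wedge_app vg mulr0.
have da : \det (\adj g) = 1.
  by have := congr1 determinant (mul_mx_adj g); rewrite det_mulmx dg mul1r det1.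
have va : wedge v (app (\adj g) v) = 0.
  by rewrite app_adj; apply: (lincomb1 (-1) vg); rewrite /wedge /=; ring.
have tra : \tr (\adj g) = \tr g.
  by rewrite adj2E !mxtrace2E !mxE /= !mulr1n; ring.
have [lt2|ge2] := ltnP (vnrm (app (\adj g) v)) (vnrm v).
  rewrite -tra; apply: (IH (\adj g) (app (\adj g) v)) => //.
  - exact: leq_trans lt2 vn.
  - exact: app_neq0.
  - by rewrite wedge_app va mulr0.
(* the eigenvalues of [g] and [g^-1] at [v] are inverse to each other *)
have prod_le i j :
    (nrm (vcoord i (app g v)) * nrm (vcoord j (app (\adj g) v)) <=
     vnrm v * vnrm v)%N.
  have [v1 v2] := nrm_coord v; rewrite -nrmM.
  suff -> : vcoord i (app g v) * vcoord j (app (\adj g) v) =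
      vcoord i v * vcoord j v.
    by apply: nrmM_le; case: (i) (j) => [] [].
  rewrite app_adj mxtrace2E; rewrite det2E in dg; rewrite /wedge /app /= in vg *.
  case: i j => [] [] /=.
  - by apply: (lincomb2 (g 0 1) (v.1 * v.1) vg dg); ring.
  - by apply: (lincomb2 (- g 0 0) (v.1 * v.2) vg dg); ring.
  - by apply: (lincomb2 (g 1 1) (v.1 * v.2) vg dg); ring.
  - by apply: (lincomb2 (- g 1 0) (v.2 * v.2) vg dg); ring.
have attained u : exists i, nrm (vcoord i u) = vnrm u.
  by case: (vnrm_attained u) => e; [exists true | exists false].
have coord_le u i : (nrm (vcoord i u) <= vnrm u)%N.
  by case: (nrm_coord u); case: i.
have v_gt0 := vnrm_gt0 v0.
have gv_le i : (nrm (vcoord i (app g v)) <= vnrm v)%N.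
  have [j ej] := attained (app (\adj g) v).
  rewrite -(leq_pmul2r v_gt0); apply: leq_trans (prod_le i j).
  by rewrite leq_mul2l ej ge2 orbT.
have av_le j : (nrm (vcoord j (app (\adj g) v)) <= vnrm v)%N.
  have [i ei] := attained (app g v).
  rewrite -(leq_pmul2l v_gt0); apply: leq_trans (prod_le i j).
  by rewrite leq_mul2r ei ge1 orbT.
have [i ei] := attained v; apply: (size_le_nrm (n := 0)).
rewrite expn0 -(leq_pmul2r v_gt0) mul1n -ei -nrmM ei.
suff -> : \tr g * vcoord i v = vcoord i (app g v) + vcoord i (app (\adj g) v).
  exact: nrmD_le.
by rewrite app_adj; case: (i) => /=; ring.
Qed.

Lemma hyperbolic_no_eigenline g : \det g = 1 -> (1 < size (\tr g))%N ->
  no_eigenline g.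
Proof.
move=> dg tg v vg; apply/eqP; apply: contraTT tg => v0.
by rewrite -leqNgt (fixed_line_trace dg v0 vg).
Qed.

(** A vector that [h] does not lengthen is nearly fixed by every [g] commuting
    with [h]: both terms of the polarised determinant formula stay small while
    the trace of [h] multiplies the left-hand side. *)
Lemma nonexpanded_near_fixed g h K v : mx_bounded g K -> g *m h = h *m g ->
  (vnrm (app h v) <= vnrm v)%N ->
  (nrm (\tr h) * nrm (wedge v (app g v)) <= K * (vnrm v * vnrm v))%N.
Proof.
move=> gK gh hv; rewrite -nrmM -wedge_trace -(app_comm _ gh).
apply: nrmD_le; last by rewrite mulnCA nrm_wedge // vnrm_app.
by rewrite mulnCA nrm_wedge // vnrm_app.
Qed.

(** The resultant of the two quadratic forms [v ^ g v] and [v ^ b v] is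
    [det (g b - b g)]: when it is nonzero, no vector is nearly fixed by both. *)
Lemma resultant_id g b v (C := g *m b - b *m g) :
  let eg := wedge v (app g v) in let eb := wedge v (app b v) in
  \det C * v.1 ^+ 3 = C 1 1 * (v.1 * (eb * g 0 1 - eg * b 0 1)) -
    C 0 1 * ((app b v).1 * eg - (app g v).1 * eb +
             v.1 * (eb * g 1 1 - eg * b 1 1)) /\
  \det C * v.2 ^+ 3 =
    C 1 0 * ((app b v).2 * eg - (app g v).2 * eb +
             v.2 * (eb * g 0 0 - eg * b 0 0)) -
    C 0 0 * (v.2 * (eb * g 1 0 - eg * b 1 0)).
Proof.
rewrite /= det2E /C !submx2E !mulmx2E /wedge /app /=; clear C.
move: (g 0 0) (g 0 1) (g 1 0) (g 1 1) (b 0 0) (b 0 1) (b 1 0) (b 1 1) v.1 v.2.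
by move=> *; split; ring.
Qed.

(** Here [T] is the factor by which [v] is nearer to an eigenline than a
    generic vector; the exponent 4 adds up the bounds [K] for the entries of [g]
    and [b] in [resultant_id] and in the hypotheses. *)
Lemma near_fixed_bound g b K T v : \det (g *m b - b *m g) != 0 -> v != 0 ->
  mx_bounded g K -> mx_bounded b K ->
  (T * nrm (wedge v (app g v)) <= K * (vnrm v * vnrm v))%N ->
  (T * nrm (wedge v (app b v)) <= K * (vnrm v * vnrm v))%N ->
  (T <= K ^ 4)%N.
Proof.
move=> dC v0 gK bK; have [id1 id2] := resultant_id g b v.
set eg := wedge v (app g v) in id1 id2 *.
set eb := wedge v (app b v) in id1 id2 *.
set C := g *m b - b *m g in dC id1 id2 => Tg Tb.
pose E := maxn (nrm eg) (nrm eb).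
have TE : (T * E <= K * (vnrm v * vnrm v))%N by rewrite /E /maxn; case: ifP.
have [geE beE] : (nrm eg <= E)%N /\ (nrm eb <= E)%N.
  by rewrite !leq_max !leqnn orbT.
have CK i j : (nrm (C i j) <= K * K)%N.
  by rewrite submx2E !mulmx2E; apply: nrmB_le; apply: nrmD_le; apply: nrmM_le.
have [v1 v2] := nrm_coord v.
have [gv1 gv2] := app_coord_le gK (leqnn (vnrm v)).
have [bv1 bv2] := app_coord_le bK (leqnn (vnrm v)).
have term k l (a : {poly F}) : (nrm a <= vnrm v)%N ->
    (nrm (a * (eb * g k l - eg * b k l)) <= K * (vnrm v * E))%N.
  move=> av; rewrite mulnCA; apply: nrmM_le => //; rewrite mulnC.
  by apply: nrmB_le; apply: nrmM_le.
have term' (x y : {poly F}) :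
    (nrm x <= K * vnrm v)%N -> (nrm y <= K * vnrm v)%N ->
    (nrm (x * eg - y * eb) <= K * (vnrm v * E))%N.
  by move=> xk yk; rewrite mulnA; apply: nrmB_le; apply: nrmM_le.
have cube_le : (vnrm v ^ 3 <= K * K * (K * (vnrm v * E)))%N.
  case: (vnrm_attained v) => {1}<-.
    rewrite -[X in (X <= _)%N]mul1n.
    apply: leq_trans (_ : nrm (\det C * v.1 ^+ 3) <= _)%N.
      by rewrite nrmM !exprS expr0 mulr1 !nrmM leq_mul ?nrm_gt0 //
        !expnS expn0 muln1.
    rewrite id1; apply: nrmB_le; apply: nrmM_le => //; first exact: term.
    by apply: nrmD_le; [exact: term' | exact: term].
  rewrite -[X in (X <= _)%N]mul1n.
  apply: leq_trans (_ : nrm (\det C * v.2 ^+ 3) <= _)%N.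
    by rewrite nrmM !exprS expr0 mulr1 !nrmM leq_mul ?nrm_gt0 //
      !expnS expn0 muln1.
  rewrite id2; apply: nrmB_le; apply: nrmM_le => //; last exact: term.
  by apply: nrmD_le; [exact: term' | exact: term].
have V0 : (0 < vnrm v ^ 3)%N by rewrite expn_gt0 vnrm_gt0.
rewrite -(leq_pmul2r V0); apply: leq_trans (leq_mul (leqnn T) cube_le) _.
rewrite (_ : _ * _ = K * K * (K * (vnrm v * (T * E))))%N; last by lia.
rewrite (_ : K ^ 4 * vnrm v ^ 3 =
  K * K * (K * (vnrm v * (K * (vnrm v * vnrm v)))))%N; last by lia.
by rewrite !leq_mul2l TE !orbT.
Qed.

(** Since [h v + h^-1 v = (tr h) v]. *)
Lemma expanded_or_inverse h v : (1 < nrm (\tr h))%N -> v != 0 ->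
  (vnrm v < vnrm (app h v))%N || (vnrm v < vnrm (app (\adj h) v))%N.
Proof.
move=> th v0; rewrite !ltnNge -negb_and; apply: contraTN th => /andP[hv av].
rewrite -leqNgt -(leq_pmul2r (vnrm_gt0 v0)) mul1n.
have [h1 h2] := nrm_coord (app h v); have [a1 a2] := nrm_coord (app (\adj h) v).
have {}h1 := leq_trans h1 hv; have {}h2 := leq_trans h2 hv.
have {}a1 := leq_trans a1 av; have {}a2 := leq_trans a2 av.
case: (vnrm_attained v) => {1}<-; rewrite -nrmM.
  suff -> : \tr h * v.1 = (app h v).1 + (app (\adj h) v).1 by apply: nrmD_le.
  by rewrite app_adj /=; ring.
suff -> : \tr h * v.2 = (app h v).2 + (app (\adj h) v).2 by apply: nrmD_le.
by rewrite app_adj /=; ring.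
Qed.

Lemma trace_square g : \det g = 1 -> (1 < nrm (\tr g))%N ->
  nrm (\tr (g *m g)) = (nrm (\tr g) ^ 2)%N.
Proof.
move=> dg tg; rewrite cayley2 dg.
have -> : \tr (\tr g *: g - 1%:M) = \tr g * \tr g - 2.
  by rewrite !mxtrace2E !mxE /= !mulr1n; ring.
rewrite nrmD_eq ?nrmM // nrmN; apply: leq_ltn_trans (_ : 1 < _)%N.
  rewrite -[2]/(2%:R) -polyC_natr; apply: (nrm_le_size (n := 0)).
  exact: size_polyC_leq1.
by rewrite -[1%N]/(1 * 1)%N ltn_mul.
Qed.

End DegreeNorm.

(** * Hyperbolic elements of non-elementary groups *)

Section Subgroups.
Variable G : groupType.
Local Open Scope group_scope.
Implicit Types (A B H K : set G).

Lemma generated_subgroup A : is_subgroup (generated A).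
Proof.
split=> [B [[B1 _ _] _] | x y Ax Ay B BA | x Ax B BA] //.
- by have [[_ BM _] _] := BA; exact: BM (Ax _ BA) (Ay _ BA).
- by have [[_ _ BV] _] := BA; exact: BV (Ax _ BA).
Qed.

Lemma generated_sub A B : is_subgroup B -> A `<=` B -> generated A `<=` B.
Proof. by move=> sB AB x; apply. Qed.

Lemma subgroup1 : is_subgroup [set 1 : G].
Proof.
by split=> [|x y /= -> ->|x /= ->] //=; rewrite ?mulg1 ?invg1.
Qed.

Lemma derived_abelian H : (forall x y, H x -> H y -> x * y = y * x) ->
  derived_subgroup H = [set 1].
Proof.
move=> cH; apply/seteqP; split; last first.
  by move=> _ ->; have [] := generated_subgroup
    [set z | exists x y, [/\ H x, H y & z = [~ x, y]]].
apply: generated_sub; first exact: subgroup1.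
by move=> _ [x [y [Hx Hy ->]]] /=; apply/eqP/commgP/cH.
Qed.

Lemma derived_sub H K : is_subgroup K ->
  (forall x y, H x -> H y -> K [~ x, y]) -> derived_subgroup H `<=` K.
Proof.
by move=> sK HK; apply: generated_sub => // _ [x [y [Hx Hy ->]]]; apply: HK.
Qed.

Lemma left_coset_eq K x y : is_subgroup K -> K (x^-1 * y) ->
  left_coset x K = left_coset y K.
Proof.
move=> [K1 KM KV] Kxy; apply/seteqP; split=> _ [k Kk <-].
- exists ((x^-1 * y)^-1 * k); first by apply: KM => //; apply: KV.
  by rewrite invgM invgK !mulgA mulgV mul1g.
- exists (x^-1 * y * k); first exact: KM.
  by rewrite !mulgA mulgV mul1g.
Qed.

Lemma virtually_soluble_soluble H : is_subgroup H -> soluble H ->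
  virtually_soluble H.
Proof.
move=> sH solH; exists H; split=> //.
apply: (sub_finite_set (B := [set left_coset 1 H])); last exact: finite_set1.
move=> _ [x Hx <-] /=; apply: left_coset_eq => //.
by have [_ HM HV] := sH; rewrite mulg1; apply: HV.
Qed.

Lemma virtually_soluble_finite H : is_subgroup H -> finite_set H ->
  virtually_soluble H.
Proof.
move=> [H1 _ _] fH; exists [set 1]; split.
- exact: subgroup1.
- by move=> _ ->.
- exact: finite_image.
- by exists 0%N.
Qed.

End Subgroups.

Section SL2.
Variable D : idomainType.
Implicit Types (g h w x y z : SL 2 D) (u v : D * D).

Lemma det_SL g : \det g = 1.
Proof. exact/eqP/det_SLval. Qed.

Lemma SL_mulE g h : (g * h)%g = g *m h :> 'M[D]_2. Proof. by []. Qed.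
Lemma SL_invE g : (g^-1)%g = \adj g :> 'M[D]_2. Proof. by []. Qed.
Lemma SL_inj g h : g = h :> 'M[D]_2 -> g = h. Proof. exact: val_inj. Qed.

Lemma app_SLM g h u : app (g * h)%g u = app g (app h u).
Proof. exact: app_mul. Qed.

Lemma app_SLK g u : app (g^-1)%g (app g u) = u.
Proof. by rewrite -app_SLM mulVg app1. Qed.

Lemma app_SLKV g u : app g (app (g^-1)%g u) = u.
Proof. by rewrite -app_SLM mulgV app1. Qed.

Lemma app_SL_neq0 g u : u != 0 -> app g u != 0.
Proof. by apply: contraNneq => gu; rewrite -(app_SLK g u) gu app0. Qed.

Lemma wedge_SL g u v : wedge (app g u) (app g v) = wedge u v.
Proof. by rewrite wedge_app det_SL mul1r. Qed.

Lemma trace_inv g : \tr (g^-1)%g = \tr g.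
Proof. by rewrite SL_invE adj2E !mxtrace2E !mxE /= !mulr1n; ring. Qed.

Lemma coord_neq0 u : u != 0 -> exists i, vcoord i u != 0.
Proof. by case/vec_neq0 => ?; [exists true | exists false]. Qed.

Lemma app_line (m : 'M[D]_2) u v i j : wedge u v = 0 ->
  vcoord i u * vcoord j (app m v) = vcoord i v * vcoord j (app m u).
Proof.
move=> uv; case: i j => [] [] /=.
- by apply: (lincomb1 (m 0 1) uv); rewrite /wedge; ring.
- by apply: (lincomb1 (m 1 1) uv); rewrite /wedge; ring.
- by apply: (lincomb1 (- m 0 0) uv); rewrite /wedge; ring.
- by apply: (lincomb1 (- m 1 0) uv); rewrite /wedge; ring.
Qed.

Lemma coord_inj u v : (forall i, vcoord i u = vcoord i v) -> u = v.
Proof.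
by case: u v => a b [c d] e; rewrite (e true : a = c) (e false : b = d).
Qed.

(** On a common fixed line the group acts through the abelian group of scalars,
    so commutators fix it pointwise. *)
Lemma commutator_fixes u x y : u != 0 ->
  wedge u (app x u) = 0 -> wedge u (app y u) = 0 -> app [~ x, y]%g u = u.
Proof.
move=> u0 ux uy; have [i ui] := coord_neq0 u0.
have key a b : wedge u (app a u) = 0 -> wedge u (app b u) = 0 -> forall j,
    vcoord i u * (vcoord i u * vcoord j (app a (app b u))) =
    vcoord i (app a u) * vcoord i (app b u) * vcoord j u.
  move=> ua ub j; rewrite (app_line _ _ _ ub).
  have /= e := app_line 1%:M i j ua; rewrite !app1 in e.
  by rewrite mulrCA e; ring.
have xy : app (x * y)%g u = app (y * x)%g u.
  rewrite !app_SLM; apply: coord_inj => j; do 2 apply: (mulfI ui).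
  by rewrite (key x y ux uy) (key y x uy ux); ring.
have -> : [~ x, y]%g = ((y * x)^-1 * (x * y))%g.
  by rewrite commgEl conjgE invgM !mulgA.
by rewrite app_SLM xy app_SLK.
Qed.

Lemma singular_of_kernel (m : 'M[D]_2) u : u != 0 -> app m u = 0 -> \det m = 0.
Proof.
move=> u0 mu; have [i ui] := coord_neq0 u0; apply: (mulfI ui); rewrite mulr0.
have /(congr1 (vcoord i)) : app (\adj m *m m) u = 0 by rewrite app_mul mu app0.
by rewrite mul_adj_mx; case: (i) => /=; rewrite !mxE ?mulr1n ?mulr0n mul0r
  ?addr0 ?add0r mulrC.
Qed.

Lemma parallel_comm (m n : 'M[D]_2) : parallel m n -> m *m n = n *m m.
Proof.
move=> mn; apply/matrixP => i j; rewrite !mulmx2E.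
by rewrite (mn i 0 0 j) (mn i 1 1 j) ![m _ j * _]mulrC.
Qed.

(** The traceless matrices that kill [u] are the multiples of a single one. *)
Lemma traceless_annihilator (m : 'M[D]_2) u : \tr m = 0 -> app m u = 0 ->
  parallel m (\matrix_(i, j)
    (vcoord (i == 0) u * (if j == 0 then - u.2 else u.1))).
Proof.
move=> tm [e0]; rewrite (trace0_entry tm) => e1.
apply: traceless_parallel => //; rewrite ?mxtrace2E !mxE /=; first by ring.
- by apply: (lincomb2 u.1 0 e0 e1); ring.
- by apply: (lincomb2 0 u.2 e0 e1); ring.
- by apply: (lincomb2 (- u.2) (- u.1) e0 e1); ring.
Qed.

(** The pointwise stabiliser of a vector is a group of transvections along a
    common line. *)
Lemma fixers_commute u g h : u != 0 -> app g u = u -> app h u = u ->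
  (g * h = h * g)%g.
Proof.
move=> u0 gu hu; apply/SL_inj; rewrite !SL_mulE.
have kills (k : 'M[D]_2) : app k u = u -> app (k - 1%:M) u = 0.
  move=> ku; have /= e1 := congr1 fst ku; have /= e2 := congr1 snd ku.
  rewrite /app !submx2E !mxE ?mulr1n ?mulr0n.
  by congr (_, _); [apply: (lincomb1 1 e1) | apply: (lincomb1 1 e2)]; ring.
have unip (k : SL 2 D) : app k u = u -> \tr (SLval k - 1%:M) = 0.
  move=> /kills/(singular_of_kernel u0) d0.
  have dk := det_SL k; rewrite det2E in dk.
  rewrite det2E !mxE !mulr1n !mulr0n in d0.
  by rewrite mxtrace2E !mxE !mulr1n; apply: (lincomb2 (-1) 1 d0 dk); ring.
have gh : parallel (SLval g - 1%:M) (SLval h - 1%:M).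
  have [i ui] := coord_neq0 u0.
  apply: parallel_trans (traceless_annihilator (unip g gu) (kills g gu))
    (traceless_annihilator (unip h hu) (kills h hu)).
  case/vec_neq0: u0 => uk; apply: contraNneq uk => /matrixP e.
    by have := e 0 1; rewrite !mxE /= => /eqP; rewrite mulf_eq0 orbb.
  by have := e 1 0; rewrite !mxE /= => /eqP; rewrite mulf_eq0 oppr_eq0 orbb.
have ex (a b : 'M[D]_2) : a *m b = (a - 1%:M) *m (b - 1%:M) + (a + b - 1%:M).
  rewrite !mulmxBl !mulmxBr !mul1mx !mulmx1; move: (a *m b) => c.
  by apply/matrixP => i j; rewrite !mxE; ring.
by rewrite ex (parallel_comm gh) (addrC (SLval g) (SLval h)) -ex.
Qed.

Lemma fixers_subgroup u : is_subgroup [set g : SL 2 D | app g u = u].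
Proof.
split=> [|g h /= gu hu|g /= gu] /=; first by rewrite app1.
- by rewrite app_SLM hu.
- by rewrite -{1}gu app_SLK.
Qed.

(** The derived group consists of transvections along the common line, so the
    second derived group is trivial. *)
Lemma common_line_soluble (H : set (SL 2 D)) u : u != 0 ->
  (forall g, H g -> wedge u (app g u) = 0) -> soluble H.
Proof.
move=> u0 Hu; exists 2%N; apply: derived_abelian => g h.
have dH : derived_subgroup H `<=` [set g | app g u = u].
  apply: derived_sub; first exact: fixers_subgroup.
  by move=> x y /Hu xu /Hu yu; apply: commutator_fixes.
by move=> /dH gu /dH hu; apply: fixers_commute gu hu.
Qed.

(** Used to see that a nilpotent matrix and [w] have a common eigenvector as
    soon as their commutator is singular. *)
Lemma nilpotent_commutator_det (n w : 'M[D]_2) : \tr n = 0 -> \det n = 0 ->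
  \det (n *m w - w *m n) = - \tr (w *m n) ^+ 2.
Proof.
move=> /trace0_entry n1; rewrite !det2E !mxtrace2E !submx2E !mulmx2E n1 => dn.
by apply: (lincomb1 (- (w 0 0 - w 1 1) ^+ 2 - w 0 1 * w 1 0 *+ 4) dn); ring.
Qed.

Lemma det_sub1 g : \det (SLval g - 1%:M) = 2 - \tr g.
Proof.
have dg := det_SL g; rewrite det2E in dg.
rewrite det2E mxtrace2E !submx2E !mxE !mulr1n !mulr0n.
by apply: (lincomb1 1 dg); ring.
Qed.

Lemma trace_sub1 g : \tr (SLval g - 1%:M) = \tr g - 2.
Proof. by rewrite !mxtrace2E !submx2E !mxE !mulr1n; ring. Qed.

(** If all commutators have trace two, a nontrivial one is a transvection, and
    its axis is fixed by the whole group. *)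
Lemma reducible_soluble (H : set (SL 2 D)) : is_subgroup H ->
  (forall x y, H x -> H y -> \det (x *m y - y *m x) = 0) -> soluble H.
Proof.
move=> [_ HM HV] dH.
case: (pselect (forall x y, H x -> H y -> x * y = y * x)%g) => [cH|].
  by exists 1%N; apply: derived_abelian.
move=> /existsNP[x /existsNP[y /not_implyP[Hx /not_implyP[Hy xy]]]].
pose z := [~ x, y]%g; pose n := SLval z - 1%:M.
have Hz : H z.
  rewrite /z commgEl conjgE.
  exact: (HM _ _ (HV _ Hx) (HM _ _ (HV _ Hy) (HM _ _ Hx Hy))).
have n0 : n != 0.
  rewrite subr_eq0; apply/eqP => z1; apply: xy; apply/commgP/eqP/SL_inj.
  exact: z1.
have dn : \det n = 0.
  have e : SLval (y * x)%g *m n = x *m y - y *m x.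
    by rewrite mulmxBr mulmx1 -[_ *m z]SL_mulE /z -commgC.
  by rewrite -(dH x y) // -e det_mulmx det_SL mul1r.
have tn : \tr n = 0.
  rewrite /n trace_sub1; move: dn; rewrite /n det_sub1 => /subr0_eq ->.
  exact: subrr.
(* the axis of the transvection [z] is spanned by any nonzero column of [n] *)
have [i [j nij]] := mx2_neq0 n0.
apply: (@common_line_soluble _ (n 0 j, n 1 j)).
  apply: contraNneq nij => -[n0j n1j]; apply/eqP.
  by move: (i); apply: ord2P.
move=> w Hw.
have tw : \tr (w *m n) = 0.
  apply/eqP; rewrite -[_ == 0]sqrf_eq0 -oppr_eq0 -nilpotent_commutator_det //.
  apply/eqP.
  by rewrite -(dH z w) // /n mulmxBl mulmxBr mul1mx mulmx1 opprB addrA subrK.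
apply: wedge_trans (singular_trace i j dn tw).
  by apply: vecN_neq0; move: nij; move: (j); apply: ord2P => ->; rewrite ?orbT.
have e : n i 0 * n 0 j + n i 1 * n 1 j = 0.
  by rewrite -mulmx2E cayley2 tn dn scale0r !mxE mul0rn subr0.
by rewrite /wedge /=; apply: (lincomb1 1 e); ring.
Qed.
End SL2.

Section Hyperbolic.
Variable F : finFieldType.
Implicit Types (H : set (SL 2 {poly F})) (g h w x y z : SL 2 {poly F}).

(** An absolutely irreducible group is determined by finitely many traces. *)
Lemma bounded_trace_finite H x y : is_subgroup H -> H x -> H y ->
  \det (x *m y - y *m x) != 0 -> (forall z, H z -> (size (\tr z) <= 1)%N) ->
  finite_set H.
Proof.
move=> [_ HM _] Hx Hy dC tH.
pose f z := ((\tr z)`_0, (\tr (x * z)%g)`_0, (\tr (y * z)%g)`_0,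
  (\tr (x * y * z)%g)`_0).
have trE z z' : H z -> H z' -> (\tr z)`_0 = (\tr z')`_0 -> \tr z = \tr z'.
  by move=> /tH/size1_polyC -> /tH/size1_polyC ->; rewrite !coefC /= => ->.
have f_inj : {in H &, injective f}.
  move=> z z'; rewrite !inE => Hz Hz' [].
  move=> /(trE _ _ Hz Hz') e1 /(trE _ _ (HM _ _ Hx Hz) (HM _ _ Hx Hz')) e2.
  move=> /(trE _ _ (HM _ _ Hy Hz) (HM _ _ Hy Hz')) e3.
  have Hxy := HM _ _ Hx Hy.
  move=> /(trE _ _ (HM _ _ Hxy Hz) (HM _ _ Hxy Hz')) e4.
  apply/SL_inj/subr0_eq; apply: (trace_form_inj dC);
    rewrite ?mulmxBr raddfB /=; apply/eqP; rewrite subr_eq0; apply/eqP => //.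
by rewrite -(eq_finite_set (inj_card_eq f_inj)); apply: finite_finset.
Qed.

Lemma hyperbolic_SL_no_eigenline g : (1 < size (\tr g))%N -> no_eigenline g.
Proof. by apply: hyperbolic_no_eigenline; exact: det_SL. Qed.

Lemma centralizer_subgroup H g : is_subgroup H ->
  is_subgroup [set z | H z /\ (g * z = z * g)%g].
Proof.
move=> [H1 HM HV]; split=> [|x y [Hx gx] [Hy gy]|x [Hx gx]] /=.
- by rewrite mulg1 mul1g.
- by split; [exact: HM | rewrite mulgA gx -mulgA gy mulgA].
- split; first exact: HV.
  by apply: (mulgI x); rewrite !mulgA -gx mulgK mulgV mul1g.
Qed.

(** Every conjugate of [g] is hyperbolic, so it commutes with [g]; having the
    same trace it is [g] or [g^-1].  The centralizer of [g] in [H] is then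
    abelian of index at most two. *)
Lemma line_stabilizer_virtually_soluble H g : is_subgroup H ->
  (1 < size (\tr g))%N -> H g ->
  (forall h, H h -> (1 < size (\tr h))%N -> \det (g *m h - h *m g) = 0) ->
  virtually_soluble H.
Proof.
move=> sH tg Hg dH; have [H1 HM HV] := sH.
have ng := hyperbolic_SL_no_eigenline tg.
pose K := [set z | H z /\ (g * z = z * g)%g].
have sK : is_subgroup K by exact: centralizer_subgroup.
have cK x y : K x -> K y -> (x * y = y * x)%g.
  move=> [_ gx] [_ gy]; apply/SL_inj.
  apply: (centralizer_comm (no_eigenline_nonscalar ng)).
    exact/esym/(congr1 (@SLval _ _) gx).
  exact/esym/(congr1 (@SLval _ _) gy).
have conj b : H b -> ~ K b -> (b^-1 * g * b = g^-1)%g.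
  move=> Hb Kb; pose h := (b^-1 * g * b)%g.
  have Hh : H h by exact: (HM _ _ (HM _ _ (HV _ Hb) Hg) Hb).
  have th : \tr h = \tr g.
    by rewrite /h SL_mulE mxtrace_mulC -SL_mulE mulgA mulgV mul1g.
  have gh : g *m h = h *m g.
    by apply: no_eigenline_comm; rewrite ?det_SL //; apply: dH => //; rewrite th.
  have [hg|hg] :=
    centralizer_trace ng (det_SL h) (det_SL g) (esym gh) (erefl _) th.
    case: Kb; split=> //; have {}hg : h = g by apply/SL_inj.
    by rewrite -{2}hg /h !mulgA mulgV mul1g.
  by apply/SL_inj.
exists K; split=> //.
- by move=> x [].
- case: (pselect (exists2 b, H b & ~ K b)) => [[b Hb Kb]|nK].
    apply: (sub_finite_set (B := [set left_coset 1%g K; left_coset b K]));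
      last exact: finite_set2.
    move=> _ [x Hx <-] /=; have [Kx|Kx] := pselect (K x).
      left; apply: left_coset_eq => //; rewrite mulg1.
      by have [_ _ KV] := sK; apply: KV.
    right; apply: left_coset_eq => //.
    split; first exact: (HM _ _ (HV _ Hx) Hb).
    have conjV c : H c -> ~ K c -> (c^-1 * g^-1 * c = g)%g.
      move=> Hc Kc; have := congr1 (fun z => z^-1)%g (conj c Hc Kc).
      by rewrite !invgM !invgK mulgA.
    have gb : (g^-1 * b = b * g)%g.
      by rewrite -[X in (_ = b * X)%g](conjV b) // !mulgA mulgV mul1g.
    have gx : (x^-1 * g^-1 = g * x^-1)%g.
      by rewrite -[X in (_ = X * _)%g](conjV x) // -!mulgA mulgV mulg1.
    by rewrite mulgA -gx -!mulgA gb.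
  apply: (sub_finite_set (B := [set left_coset 1%g K]));
    last exact: finite_set1.
  move=> _ [x Hx <-] /=; have [Kx|Kx] := pselect (K x).
    apply: left_coset_eq => //; rewrite mulg1.
    by have [_ _ KV] := sK; apply: KV.
  by case: nK; exists x.
- by exists 1%N; apply: derived_abelian.
Qed.

Lemma hyperbolic_pair H : is_subgroup H -> non_elementary H ->
  exists g1 g2, [/\ H g1, H g2, (1 < size (\tr g1))%N, (1 < size (\tr g2))%N &
    \det (g1 *m g2 - g2 *m g1) != 0].
Proof.
move=> sH nH; apply: contrapT => no.
have [x [y [Hx Hy xy]]] :
    exists x y, [/\ H x, H y & \det (x *m y - y *m x) != 0].
  apply: contrapT => irr.
  apply/nH/virtually_soluble_soluble/reducible_soluble => //.
  move=> x y Hx Hy; apply/eqP; apply: contrapT => /negP xy.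
  by apply: irr; exists x, y.
have [g Hg tg] : exists2 g, H g & (1 < size (\tr g))%N.
  apply: contrapT => nhyp; apply/nH/virtually_soluble_finite => //.
  apply: (bounded_trace_finite sH Hx Hy xy) => z Hz.
  rewrite leqNgt; apply/negP => tz.
  by apply: nhyp; exists z.
apply/nH/(line_stabilizer_virtually_soluble sH tg Hg) => h Hh th.
apply/eqP; apply: contrapT => /negP gh; apply: no; exists g, h; split=> //.
Qed.

End Hyperbolic.

(** * Exponentially small sequences *)

Section ExponentialDecay.
Variable R : realFieldType.
Implicit Types (b : nat -> R).

(** The constant is required to be at least 1 so that it is bounded by its
    powers when roots are taken. *)
Definition exp_small b := exists C theta : R,
  [/\ 1 <= C, 0 < theta, theta < 1 & forall n, b n <= C * theta ^+ n].

Lemma bernoulli (x : R) n : 0 <= x <= 1 -> 1 - n%:R * x <= (1 - x) ^+ n.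
Proof.
move=> /andP[x0 x1]; elim: n => [|n IH]; first by rewrite mul0r subr0 expr0.
have := ler_wpM2l (_ : 0 <= 1 - x) IH; rewrite subr_ge0 x1 -exprS => /(_ isT).
apply: le_trans; rewrite -natr1.
have : 0 <= n%:R * x * x :> R by rewrite !mulr_ge0 // ler0n.
by lra.
Qed.

(** Bernoulli's inequality provides a ratio whose [k]-th power is large enough;
    this stays inside any ordered field. *)
Lemma approx_root (theta : R) k : 0 < theta -> theta < 1 -> (0 < k)%N ->
  exists t, [/\ 0 < t, t < 1 & theta <= t ^+ k].
Proof.
move=> t0 t1 k0; have kR : 0 < k%:R :> R by rewrite ltr0n.
have k1 : 1 <= k%:R :> R by rewrite ler1n.
have x0 : 0 < (1 - theta) / k%:R by rewrite divr_gt0 // subr_gt0.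
have x1 : (1 - theta) / k%:R < 1 by rewrite ltr_pdivrMr // mul1r; lra.
exists (1 - (1 - theta) / k%:R); split; [lra|lra|].
have x01 : 0 <= (1 - theta) / k%:R <= 1 by rewrite !ltW.
apply: le_trans (bernoulli k x01); rewrite mulrC divfK ?gt_eqF //; lra.
Qed.

Lemma exp_small_le b b' : exp_small b' -> (forall n, b n <= b' n) ->
  exp_small b.
Proof.
move=> [C [t [C1 t0 t1 bt]]] bb; exists C, t; split=> // n.
exact: le_trans (bb n) (bt n).
Qed.

Lemma exp_smallD b b' : exp_small b -> exp_small b' ->
  exp_small (fun n => b n + b' n).
Proof.
move=> [C [t [C1 t0 t1 bt]]] [C' [t' [C1' t0' t1' bt']]].
exists (C + C'), (Num.max t t').
split; [lra|by rewrite lt_max t0|by rewrite gt_max t1|].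
have C0 : 0 <= C by lra.
have C0' : 0 <= C' by lra.
have [tw tw'] := (ltW t0, ltW t0').
move=> n; rewrite mulrDl lerD //.
  apply: le_trans (bt n) _; rewrite ler_wpM2l //.
  by rewrite lerXn2r // ?nnegrE ?le_max ?lexx ?tw.
apply: le_trans (bt' n) _; rewrite ler_wpM2l //.
by rewrite lerXn2r // ?nnegrE ?le_max ?lexx ?tw' ?orbT.
Qed.

Lemma exp_smallZ b (c : R) : 0 <= c -> exp_small b ->
  exp_small (fun n => c * b n).
Proof.
move=> c0 [C [t [C1 t0 t1 bt]]]; exists ((c + 1) * C), t; split=> //.
  by rewrite -[X in X <= _]mul1r ler_pM //; lra.
move=> n; apply: le_trans (ler_wpM2l c0 (bt n)) _.
have Ct : 0 <= C * t ^+ n by rewrite mulr_ge0 ?exprn_ge0 ?ltW //; lra.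
by rewrite -mulrA ler_wpM2r //; lra.
Qed.

Lemma exp_small_root b k : (0 < k)%N -> exp_small b ->
  exists2 r, exp_small r & forall n, 0 <= r n /\ b n <= r n ^+ k.
Proof.
move=> k0 [C [t [C1 t0 t1 bt]]]; have [s [s0 s1 ts]] := approx_root t0 t1 k0.
have C0 : 0 <= C by lra.
exists (fun n => C * s ^+ n); first by exists C, s; split.
move=> n; have sn0 : 0 <= s ^+ n by rewrite exprn_ge0 ?ltW.
split; first by rewrite mulr_ge0.
apply: le_trans (bt n) _; rewrite exprMn.
apply: ler_pM => //; first by rewrite exprn_ge0 ?ltW.
  by rewrite -[X in X <= _]expr1 ler_weXn2l.
have [tw sw] := (ltW t0, ltW s0).
by rewrite exprAC lerXn2r ?nnegrE ?exprn_ge0.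
Qed.

Lemma exp_small_div b k : (0 < k)%N -> exp_small b ->
  exp_small (fun n => b (n %/ k)%N).
Proof.
move=> k0 [C [t [C1 t0 t1 bt]]]; have [s [s0 s1 ts]] := approx_root t0 t1 k0.
have sk0 : 0 < s ^+ k by rewrite exprn_gt0.
have sk1 : s ^+ k <= 1 by rewrite exprn_ile1 ?ltW.
exists (C / s ^+ k), s; split=> //.
  by rewrite ler_pdivlMr // mul1r; lra.
move=> n; apply: le_trans (bt _) _; rewrite -mulrA ler_wpM2l //; first lra.
rewrite ler_pdivlMl //.
apply: (le_trans (y := s ^+ k * (s ^+ k) ^+ (n %/ k))).
  have [tw skw] := (ltW t0, ltW sk0).
  by rewrite ler_wpM2l // lerXn2r ?nnegrE.
rewrite -exprM -exprD ler_wiXn2l ?ltW //.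
by rewrite {1}(divn_eq n k) addnC mulnC leq_add2r ltnW // ltn_mod.
Qed.

(** Half of the exponential decay absorbs the linear factor. *)
Lemma exp_small_linear b : exp_small b -> exp_small (fun n => n%:R * b n).
Proof.
move=> [C [t [C1 t0 t1 bt]]].
have [s [s0 s1 ts]] := approx_root t0 t1 (isT : (0 < 2)%N).
have x0 : 0 < s^-1 - 1 by rewrite subr_gt0 invf_gt1.
have C0 : 0 <= C by lra.
have sn n : n%:R * s ^+ n <= (s^-1 - 1)^-1.
  rewrite -[leRHS]mul1r ler_pdivlMr // mulrAC.
  suff : (1 + n%:R * (s^-1 - 1)) * s ^+ n <= 1.
    by apply: le_trans; rewrite ler_wpM2r ?exprn_ge0 ?(ltW s0) //; lra.
  elim: n => [|n IH]; first by rewrite mul0r addr0 mulr1.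
  apply: le_trans IH; rewrite exprS mulrA ler_wpM2r ?exprn_ge0 ?(ltW s0) //.
  rewrite -ler_pdivlMr // -natr1.
  have : 0 <= n%:R * (s^-1 - 1) * (s^-1 - 1).
    by rewrite !mulr_ge0 ?ler0n ?(ltW x0).
  by lra.
exists (C * Num.max 1 (s^-1 - 1)^-1), s; split=> //.
  by rewrite -[X in X <= _]mul1r ler_pM // le_max lexx.
move=> n; apply: (le_trans (y := n%:R * (C * t ^+ n))).
  by rewrite ler_wpM2l.
rewrite mulrCA -mulrA ler_wpM2l //.
apply: (le_trans (y := n%:R * s ^+ n * s ^+ n)).
  rewrite -mulrA ler_wpM2l // -exprD addnn -mul2n exprM.
  have [tw sw] := (ltW t0, ltW s0).
  by rewrite lerXn2r ?nnegrE ?exprn_ge0.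
rewrite ler_wpM2r ?exprn_ge0 ?(ltW s0) // le_max; apply/orP; right; exact: sn.
Qed.

End ExponentialDecay.

(** * Random words in a symmetric set *)

Section Walk.
Variables (R : realFieldType) (G : groupType) (S : seq G).
Hypothesis S_gt0 : (0 < size S)%N.
Implicit Types (phi psi : G -> R) (P Q : pred G) (n m : nat).

(** Repetitions are kept, so that averages over the list are expectations. *)
Fixpoint words n : seq G :=
  if n is m.+1 then [seq (s * w)%g | s <- S, w <- words m] else [:: 1%g].

Definition expect n phi : R := (\sum_(w <- words n) phi w) / (size S ^ n)%:R.

Lemma size_words n : size (words n) = (size S ^ n)%N.
Proof. by elim: n => //= n IH; rewrite size_allpairs IH expnS. Qed.

Let Sn_gt0 n : 0 < (size S ^ n)%:R :> R.
Proof. by rewrite ltr0n expn_gt0 S_gt0. Qed.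

Let Sn_neq0 n : (size S ^ n)%:R != 0 :> R.
Proof. by rewrite gt_eqF. Qed.

Lemma expect0 phi : expect 0 phi = phi 1%g.
Proof. by rewrite /expect /= big_seq1 divr1. Qed.

Lemma expectS n phi :
  expect n.+1 phi =
    (\sum_(s <- S) expect n (fun w => phi (s * w)%g)) / (size S)%:R.
Proof.
rewrite /expect /= big_allpairs_dep /= -mulr_suml expnS mulnC natrM invfM.
by rewrite -mulrA.
Qed.

Lemma eq_expect n phi psi : {in words n, phi =1 psi} ->
  expect n phi = expect n psi.
Proof. by move=> e; rewrite /expect (eq_big_seq psi e). Qed.

Lemma le_expect n phi psi : {in words n, forall w, phi w <= psi w} ->
  expect n phi <= expect n psi.
Proof.
move=> e; rewrite /expect ler_pM2r ?invr_gt0 // big_seq [leRHS]big_seq.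
exact: ler_sum.
Qed.

Lemma expect_cst n c : expect n (fun=> c) = c.
Proof.
rewrite /expect big_const_seq count_predT iter_addr addr0 size_words.
by rewrite -[X in X / _]mulr_natr mulfK.
Qed.

Lemma expectD n phi psi :
  expect n (fun w => phi w + psi w) = expect n phi + expect n psi.
Proof. by rewrite /expect big_split mulrDl. Qed.

Lemma expectZ n c phi : expect n (fun w => c * phi w) = c * expect n phi.
Proof. by rewrite /expect -mulr_sumr mulrA. Qed.

Lemma expectZr n c phi : expect n (fun w => phi w * c) = expect n phi * c.
Proof. by rewrite /expect -mulr_suml mulrAC. Qed.

Lemma expect_sum n (I : Type) (r : seq I) (P : pred I) (f : I -> G -> R) :
  expect n (fun w => \sum_(i <- r | P i) f i w) =
    \sum_(i <- r | P i) expect n (f i).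
Proof. by rewrite /expect exchange_big mulr_suml. Qed.

Lemma expect_ge0 n phi : (forall w, 0 <= phi w) -> 0 <= expect n phi.
Proof. by move=> p; rewrite -(expect_cst n 0); apply: le_expect. Qed.

Lemma expect_le_cst n c phi : {in words n, forall w, phi w <= c} ->
  expect n phi <= c.
Proof. by move=> e; rewrite -[leRHS](expect_cst n); apply: le_expect. Qed.

Lemma exchange_expect n m (f : G -> G -> R) :
  expect n (fun x => expect m (f x)) = expect m (fun y => expect n (f^~ y)).
Proof. by rewrite /expect -!mulr_suml exchange_big /= mulrAC. Qed.

Lemma expect_add n m phi :
  expect (n + m) phi = expect n (fun x => expect m (fun y => phi (x * y)%g)).
Proof.
elim: n phi => [|n IH] phi.
  by rewrite expect0; apply: eq_expect => y _; rewrite mul1g.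
rewrite addSn !expectS; congr (_ / _); apply: eq_bigr => s _; rewrite IH.
by apply: eq_expect => x _; apply: eq_expect => y _; rewrite mulgA.
Qed.

Lemma expect_sqr n phi : expect n phi ^+ 2 =
  expect n (fun x => expect n (fun y => phi x * phi y)).
Proof. by under [in RHS]eq_fun do rewrite expectZ; rewrite expectZr expr2. Qed.

(** The difference is the variance. *)
Lemma sqr_expect_le n phi :
  expect n phi ^+ 2 <= expect n (fun x => phi x ^+ 2).
Proof.
rewrite -subr_ge0.
have -> : expect n (fun x => phi x ^+ 2) - expect n phi ^+ 2 =
    expect n (fun x => (phi x - expect n phi) ^+ 2).
  transitivity (expect n (fun x => phi x ^+ 2 + ((- 2 * expect n phi) * phi x +
    expect n phi ^+ 2))); last by apply: eq_expect => x _; ring.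
  rewrite !expectD expectZ expect_cst; ring.
by apply: expect_ge0 => x; apply: sqr_ge0.
Qed.

(** One word of probability [(size S ^ n)^-1] at which [phi] stays below its
    bound already improves the bound for the mean. *)
Lemma expect_atom n phi (M : R) g : g \in words n ->
  {in words n, forall w, phi w <= M} ->
  expect n phi <= M - (M - phi g) / (size S ^ n)%:R.
Proof.
move=> gw le_M; rewrite -{1}(expect_cst n M) /expect -mulrBl ler_pM2r ?invr_gt0 //.
rewrite lerBrDl -lerBrDr -sumrB (perm_big _ (perm_to_rem gw)) big_cons /= lerDl.
by rewrite big_seq sumr_ge0 // => w /mem_rem/le_M; rewrite subr_ge0.
Qed.

Lemma mem_words_mul n m x y : x \in words n -> y \in words m ->
  (x * y)%g \in words (n + m).
Proof.
elim: n x => [|n IH] x /=; first by rewrite inE => /eqP -> ; rewrite mul1g.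
move=> /allpairsP[[s w] /= [sS wn ->]] ym; rewrite -mulgA.
by apply/allpairsP; exists (s, (w * y)%g); split=> //; apply: IH.
Qed.

Hypothesis S_uniq : uniq S.
Hypothesis S_inv : {in S, forall s, s^-1%g \in S}.

Lemma sum_inv phi : \sum_(s <- S) phi s^-1%g = \sum_(s <- S) phi s.
Proof.
rewrite -(big_map (fun s => s^-1%g) predT phi); apply: perm_big.
apply: uniq_perm => //; first by rewrite map_inj_uniq //; exact: invg_inj.
move=> s; apply/mapP/idP => [[t tS ->]|sS]; first exact: S_inv.
by exists s^-1%g; rewrite ?invgK ?S_inv.
Qed.

Lemma expect1 phi : expect 1 phi = (\sum_(s <- S) phi s) / (size S)%:R.
Proof.
by rewrite expectS; congr (_ / _); apply: eq_bigr => s _; rewrite expect0 mulg1.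
Qed.

Lemma expect_inv n phi : expect n (fun w => phi w^-1%g) = expect n phi.
Proof.
elim: n phi => [|n IH] phi; first by rewrite !expect0 invg1.
rewrite -[in RHS]addn1 expect_add exchange_expect expect1 expectS -sum_inv.
congr (_ / _); apply: eq_bigr => s _; rewrite -(IH (fun x => phi (x * s)%g)).
by apply: eq_expect => w _; rewrite invgM invgK.
Qed.

Lemma mem_words_inv n x : x \in words n -> x^-1%g \in words n.
Proof.
elim: n x => [|n IH] x; first by rewrite !inE => /eqP ->; rewrite invg1.
move=> /allpairsP[[s w] /= [sS wn ->]]; rewrite invgM.
have s1 : s^-1%g \in words 1.
  by apply/allpairsP; exists (s^-1%g, 1%g); rewrite mem_seq1 mulg1 S_inv.
by have := mem_words_mul (IH _ wn) s1; rewrite addn1.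
Qed.

(** Padding with a letter and its inverse, to give several elements a common
    length. *)
Lemma mem_words_pad n k x : x \in words n -> x \in words (k.*2 + n).
Proof.
move=> xn; elim: k => // k IH; rewrite doubleS !addSn.
have [s sS] : exists s, s \in S.
  by case: (S) S_gt0 => // s S' _; exists s; rewrite mem_head.
apply/allpairsP; exists (s, s^-1 * x)%g; rewrite /= mulVKg; split=> //.
by apply/allpairsP; exists (s^-1, x)%g; rewrite S_inv.
Qed.

Lemma generated_words :
  generated [set` S] `<=` [set g | exists n, g \in words n].
Proof.
apply: generated_sub.
  split=> [|x y /= [n xn] [m ym]|x /= [n xn]].
  - by exists 0%N; rewrite mem_seq1.
  - by exists (n + m)%N; apply: mem_words_mul.
  - by exists n; apply: mem_words_inv.
move=> s /= sS; exists 1%N; apply/allpairsP; exists (s, 1%g).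
by rewrite mem_seq1 mulg1.
Qed.

End Walk.

(** * Spectral gap on the projective line *)

(** Schur's test for the operator that translates by [h].  Let c(x) be the
    number of y in [L] equivalent to x: this is the function on the classes
    whose square norm is the sum of c over [L], and the left-hand side is twice
    its inner product with its translate.  The bound is the inequality
    2 c(h x) <= t(x) c(x) + c(h x)^2 / (t(x) c(x)), summed over [L]. *)
Lemma weighted_pairs (R : realFieldType) (X : eqType) (L : seq X) (e : rel X)
    (h h' : X -> X) (t : X -> R) :
  reflexive e -> symmetric e -> transitive e ->
  (forall x y, e (h x) y = e x (h' y)) ->
  (forall x, 0 < t x) -> (forall x y, e x y -> t x = t y) ->
  2 * \sum_(x <- L) \sum_(y <- L) (e (h x) y)%:R <=
    \sum_(x <- L) (t x + (t (h' x))^-1) * \sum_(y <- L) (e x y)%:R.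
Proof.
move=> e_refl e_sym e_trans eh t_gt0 t_class.
pose c x : R := \sum_(y <- L) (e x y)%:R.
have c_ge0 x : 0 <= c x by apply: sumr_ge0 => y _; rewrite ler0n.
have c_class x y : e x y -> c x = c y.
  move=> exy; apply: eq_bigr => z _; congr (nat_of_bool _)%:R.
  by apply/idP/idP; apply: e_trans; rewrite // e_sym.
have c_gt0 x : x \in L -> 0 < c x.
  move=> xL; rewrite /c (perm_big _ (perm_to_rem xL)) big_cons e_refl.
  by rewrite ltr_pwDl ?ltr01 // sumr_ge0 // => y _; rewrite ler0n.
have amgm x : x \in L -> 2 * c (h x) <= t x * c x + c (h x) ^+ 2 / (t x * c x).
  move=> xL; have p : 0 < t x * c x by rewrite mulr_gt0 ?c_gt0.
  rewrite -subr_ge0.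
  have -> : t x * c x + c (h x) ^+ 2 / (t x * c x) - 2 * c (h x) =
     (t x * c x - c (h x)) ^+ 2 / (t x * c x) by field; rewrite !gt_eqF ?c_gt0.
  by rewrite divr_ge0 ?sqr_ge0 ?ltW.
have swap : \sum_(x <- L) c (h x) ^+ 2 / (t x * c x) <=
    \sum_(y <- L) (t (h' y))^-1 * c y.
  have -> : \sum_(x <- L) c (h x) ^+ 2 / (t x * c x) =
      \sum_(x <- L) \sum_(y <- L) (e x (h' y))%:R * (c y / (t (h' y) * c (h' y))).
    apply: eq_bigr => x _; rewrite expr2 -mulrA mulr_suml.
    apply: eq_bigr => y _.
    rewrite -eh; case: (boolP (e (h x) y)) => [exy|_]; last by rewrite !mul0r.
    by rewrite -(c_class _ _ exy); move: exy; rewrite eh => exy;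
       rewrite -(c_class _ _ exy) (t_class _ _ exy).
  rewrite exchange_big /=; apply: ler_sum => y _; rewrite -mulr_suml.
  have -> : \sum_(x <- L) (e x (h' y))%:R = c (h' y).
    by apply: eq_bigr => x _; rewrite e_sym.
  have [->|cy] := eqVneq (c (h' y)) 0.
    by rewrite mul0r mulr_ge0 ?invr_ge0 ?(ltW (t_gt0 _)).
  by rewrite le_eqVlt; apply/orP; left; apply/eqP; field; rewrite cy gt_eqF.
apply: (le_trans (y := \sum_(x <- L) (t x * c x + c (h x) ^+ 2 / (t x * c x)))).
  by rewrite mulr_sumr big_seq [leRHS]big_seq; apply: ler_sum => x; exact: amgm.
rewrite big_split /=; apply: le_trans (lerD (lexx _) swap) _.
by rewrite -big_split /= ler_sum // => x _; rewrite mulrDl.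
Qed.

Section Collisions.
Variables (R : realFieldType) (F : fieldType) (S : seq (SL 2 {poly F})).
Local Notation G := (SL 2 {poly F}).
Hypothesis S_gt0 : (0 < size S)%N.
Hypothesis S_uniq : uniq S.
Hypothesis S_inv : {in S, forall s, s^-1%g \in S}.
Implicit Types (u v : {poly F} * {poly F}) (x y z g h w : G) (n m : nat).

Definition collinear u x y := wedge (app x u) (app y u) == 0.

Lemma collinear_mul u x y z :
  collinear u (z * x)%g y = collinear u x (z^-1 * y)%g.
Proof. by rewrite /collinear -(wedge_SL z^-1%g) -!app_SLM mulKg. Qed.

Lemma collinear_refl u : reflexive (collinear u).
Proof. by move=> x; rewrite /collinear wedgevv. Qed.

Lemma collinear_sym u : symmetric (collinear u).
Proof. by move=> x y; rewrite /collinear wedgeC oppr_eq0. Qed.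

Lemma collinear_trans u : u != 0 -> transitive (collinear u).
Proof.
move=> u0 y x z /eqP xy /eqP yz; apply/eqP.
exact: wedge_trans (app_SL_neq0 y u0) xy yz.
Qed.

(** Only the sign of the change of length matters.  This makes the weight of
    [z] at [z^-1 v] the inverse of the weight of [z^-1] at [v], and bounds the
    cost of the vectors that [z] shortens. *)
Definition stretch_weight z v : R :=
  if (vnrm v < vnrm (app z v))%N then 2^-1
  else if (vnrm (app z v) < vnrm v)%N then 2 else 1.

Lemma stretch_weight_gt0 z v : 0 < stretch_weight z v.
Proof.
by rewrite /stretch_weight; do 2 case: ifP => _ //; rewrite invr_gt0.
Qed.

Lemma stretch_weight_inv z v :
  (stretch_weight z (app z^-1%g v))^-1 = stretch_weight z^-1%g v.
Proof.
rewrite /stretch_weight app_SLKV.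
by case: ltngtP => _; rewrite ?invrK ?invr1.
Qed.

(** The factor by which a matrix changes lengths depends only on the line. *)
Lemma vnrm_app_line (z : 'M[{poly F}]_2) u v : wedge u v = 0 ->
  (vnrm u * vnrm (app z v) = vnrm v * vnrm (app z u))%N.
Proof.
have attained (w : {poly F} * {poly F}) : exists i, nrm (vcoord i w) = vnrm w.
  by case: (vnrm_attained w) => e; [exists true | exists false].
have vcoord_le (w : {poly F} * {poly F}) i : (nrm (vcoord i w) <= vnrm w)%N.
  by case: (nrm_coord w); case: i.
have le a b : wedge a b = 0 ->
    (vnrm a * vnrm (app z b) <= vnrm b * vnrm (app z a))%N.
  move=> ab; have [[i <-] [j <-]] := (attained a, attained (app z b)).
  by rewrite -nrmM (app_line _ _ _ ab) nrmM leq_mul.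
by move=> uv; apply/eqP; rewrite eqn_leq !le // wedgeC uv oppr0.
Qed.

Lemma stretch_weight_line z u v : u != 0 -> v != 0 -> wedge u v = 0 ->
  stretch_weight z u = stretch_weight z v.
Proof.
move=> /vnrm_gt0 u0 /vnrm_gt0 v0 /(vnrm_app_line z) e; rewrite /stretch_weight.
have -> : (vnrm u < vnrm (app z u))%N = (vnrm v < vnrm (app z v))%N.
  by rewrite -(ltn_pmul2l v0) -e mulnC ltn_pmul2l.
have -> // : (vnrm (app z u) < vnrm u)%N = (vnrm (app z v) < vnrm v)%N.
by rewrite -(ltn_pmul2l v0) -e [(vnrm v * _)%N]mulnC ltn_pmul2l.
Qed.

(** Inner product of the law of the line of [x u] with its translate by [z]. *)
Definition overlap n u z : R :=
  expect S n (fun x => expect S n (fun y => (collinear u (z * x)%g y)%:R)).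

(** Square norm of the law of the line of [x u]. *)
Definition collision n u : R :=
  expect S n (fun x => expect S n (fun y => (collinear u x y)%:R)).

Lemma overlap_sum n u z : overlap n u z =
  (\sum_(x <- words S n) \sum_(y <- words S n) (collinear u (z * x)%g y)%:R)
    / (size S ^ n)%:R ^+ 2.
Proof. by rewrite /overlap /expect -mulr_suml -mulrA -invfM expr2. Qed.

Lemma overlap_le n u z (t : G -> R) : u != 0 ->
  (forall x, 0 < t x) -> (forall x y, collinear u x y -> t x = t y) ->
  2 * overlap n u z <= expect S n (fun x =>
    (t x + (t (z^-1 * x)%g)^-1) * expect S n (fun y => (collinear u x y)%:R)).
Proof.
move=> u0 t0 tc; have := weighted_pairs (words S n) (@collinear_refl u)
  (@collinear_sym u) (collinear_trans u0) (fun x y => collinear_mul u x y z)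
  t0 tc.
have SS : 0 < ((size S ^ n)%:R ^+ 2)^-1 :> R.
  by rewrite invr_gt0 exprn_gt0 // ltr0n expn_gt0 S_gt0.
rewrite -(ler_pM2r SS) -mulrA -overlap_sum => /le_trans; apply.
rewrite /expect; under [in leRHS]eq_bigr do rewrite mulrA.
by rewrite -mulr_suml -mulrA -invfM expr2.
Qed.

Lemma overlap_le_collision n u z : u != 0 -> overlap n u z <= collision n u.
Proof.
move=> u0.
have := @overlap_le n u z (fun=> 1) u0 (fun=> ltr01) (fun _ _ _ => erefl).
by rewrite invr1 expectZ ler_pM2l.
Qed.

(** The trivial bound is 2 times the collision probability, so the sum of the
    four weights has to be less than 4. *)
Lemma overlap_pair n u h1 h2 : u != 0 ->
  (forall v, v != 0 -> stretch_weight h1 v + stretch_weight h1^-1%g v +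
     (stretch_weight h2 v + stretch_weight h2^-1%g v) <= 7 / 2) ->
  overlap n u h1 + overlap n u h2 <= 7 / 4 * collision n u.
Proof.
move=> u0 hw.
have key h : 2 * overlap n u h <= expect S n (fun x =>
    (stretch_weight h (app x u) + stretch_weight h^-1%g (app x u)) *
    expect S n (fun y => (collinear u x y)%:R)).
  have := @overlap_le n u h (fun x => stretch_weight h (app x u)) u0
    (fun x => stretch_weight_gt0 _ _)
    (fun x y xy => stretch_weight_line h (app_SL_neq0 x u0)
      (app_SL_neq0 y u0) (eqP xy)).
  move=> /le_trans; apply; apply: le_expect => // x _.
  by rewrite app_SLM stretch_weight_inv.
have := lerD (key h1) (key h2); rewrite -expectD => le12.
suff : 2 * overlap n u h1 + 2 * overlap n u h2 <= 7 / 2 * collision n u by lra.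
apply: le_trans le12 _; rewrite /collision -expectZ; apply: le_expect => // x _.
rewrite -mulrDl ler_wpM2r //; last exact/hw/app_SL_neq0.
by apply: expect_ge0 => // y; rewrite ler0n.
Qed.

(** Moving the last [m] letters of one word to the other writes the collision
    probability as a mean of overlaps over words of length [2 m]; [h1] and [h2]
    contribute less than the others. *)
Lemma collision_step n m u h1 h2 : u != 0 ->
  h1 \in words S (m + m) -> h2 \in words S (m + m) ->
  (forall v, v != 0 -> stretch_weight h1 v + stretch_weight h1^-1%g v +
     (stretch_weight h2 v + stretch_weight h2^-1%g v) <= 7 / 2) ->
  collision (m + n) u <= (1 - (8 * (size S ^ (m + m))%:R)^-1) * collision n u.
Proof.
move=> u0 w1 w2 hw; have pair := overlap_pair n u0 hw.
have -> : collision (m + n) u = expect S (m + m) (overlap n u).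
  rewrite [RHS]expect_add exchange_expect /collision expect_add.
  apply: eq_expect => a _; rewrite -[RHS](expect_inv S_uniq S_inv).
  under eq_fun do rewrite expect_add; rewrite exchange_expect.
  apply: eq_expect => b _; apply: eq_expect => x _; apply: eq_expect => y _.
  by rewrite -mulgA [in RHS]collinear_mul invgK.
have atom h : h \in words S (m + m) -> _ := fun hm =>
  expect_atom S_gt0 hm (fun z _ => overlap_le_collision n z u0).
have := lerD (atom h1 w1) (atom h2 w2).
set E := expect _ _ _; set c := collision n u in pair *.
set o1 := overlap n u h1 in pair *; set o2 := overlap n u h2 in pair *.
set N : R := (size S ^ (m + m))%:R.
have N0 : 0 < N by rewrite ltr0n expn_gt0 S_gt0.
have : 0 <= (7 / 4 * c - (o1 + o2)) / N by rewrite divr_ge0 ?subr_ge0 // ltW.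
rewrite invfM => h; lra.
Qed.

Lemma collision_le1 n u : collision n u <= 1.
Proof.
apply: expect_le_cst => // x _; apply: expect_le_cst => // y _.
by case: collinear.
Qed.

Lemma collision_small m h1 h2 : (0 < m)%N ->
  h1 \in words S (m + m) -> h2 \in words S (m + m) ->
  (forall v, v != 0 -> stretch_weight h1 v + stretch_weight h1^-1%g v +
     (stretch_weight h2 v + stretch_weight h2^-1%g v) <= 7 / 2) ->
  exists2 b, exp_small b & forall n u, u != 0 -> collision n u <= b n.
Proof.
move=> m0 w1 w2 hw; set rho := 1 - (8 * (size S ^ (m + m))%:R)^-1 : R.
have N1 : 1 <= (size S ^ (m + m))%:R :> R by rewrite ler1n expn_gt0 S_gt0.
have rho0 : 0 < rho by rewrite subr_gt0 invf_lt1; lra.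
have rho1 : rho < 1 by rewrite ltrBlDr ltrDl invr_gt0; lra.
exists (fun n => rho ^+ (n %/ m)).
  apply: (exp_small_div (b := fun n => rho ^+ n)) => //.
  by exists 1, rho; split=> // n; rewrite mul1r.
move=> n u u0; rewrite {1}(divn_eq n m).
elim: (n %/ m)%N => [|k IH]; first by rewrite expr0 collision_le1.
rewrite mulSn -addnA exprS; apply: le_trans (collision_step _ u0 w1 w2 hw) _.
by rewrite ler_wpM2l // ltW.
Qed.

(** The probabilistic meaning of collisions: an event that confines the walk
    from [u] to one line has small probability. *)
Lemma one_line_le n u (P : pred G) :
  {in words S n &, forall x y, P x -> P y -> collinear u x y} ->
  expect S n (fun x => (P x)%:R) ^+ 2 <= collision n u.
Proof.
move=> hP; rewrite expect_sqr.
apply: le_expect => // x xn; apply: le_expect => // y yn.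
rewrite -natrM ler_nat mulnb; case: (boolP (P x && P y)) => // /andP[Px Py].
by rewrite hP.
Qed.

End Collisions.

Section Growth.
Variables (R : realFieldType) (F : fieldType).
Local Notation G := (SL 2 {poly F}).
Implicit Types (g h : G) (v : {poly F} * {poly F}).

(** A vector that neither of two powers of [g1] and [g2] lengthens would be
    nearly fixed by both [g1] and [g2].  So if one of the four powers fails to
    lengthen [v], the two belonging to the other element do not fail, and
    neither does its own inverse: the sum is at most 3 / 2 + 2. *)
Lemma stretch_weights g1 g2 h1 h2 K v :
  \det (g1 *m g2 - g2 *m g1) != 0 -> mx_bounded g1 K -> mx_bounded g2 K ->
  (g1 * h1 = h1 * g1)%g -> (g2 * h2 = h2 * g2)%g ->
  (1 < nrm (\tr h1))%N -> (1 < nrm (\tr h2))%N ->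
  (K ^ 4 < nrm (\tr h1))%N -> (K ^ 4 < nrm (\tr h2))%N -> v != 0 ->
  stretch_weight R h1 v + stretch_weight R h1^-1%g v +
  (stretch_weight R h2 v + stretch_weight R h2^-1%g v) <= 7 / 2.
Proof.
have num : 2^-1 + 2^-1 + 5 / 2 <= 7 / 2 :> R by lra.
move=> dC K1 K2 gh1 gh2 t1 t2 T1 T2 v0.
have near h h' : (g1 * h = h * g1)%g -> (g2 * h' = h' * g2)%g ->
    (K ^ 4 < nrm (\tr h))%N -> (K ^ 4 < nrm (\tr h'))%N ->
    (vnrm v < vnrm (app h v))%N || (vnrm v < vnrm (app h' v))%N.
  move=> gh gh' T T'; rewrite !ltnNge -negb_and; apply/negP => /andP[hv hv'].
  have n1 := nonexpanded_near_fixed K1 (congr1 (@SLval _ _) gh) hv.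
  have n2 := nonexpanded_near_fixed K2 (congr1 (@SLval _ _) gh') hv'.
  suff : (minn (nrm (\tr h)) (nrm (\tr h')) <= K ^ 4)%N.
    by rewrite leqNgt leq_min T T'.
  apply: (near_fixed_bound dC v0 K1 K2).
    by apply: leq_trans n1; rewrite leq_mul2r geq_minl orbT.
  by apply: leq_trans n2; rewrite leq_mul2r geq_minr orbT.
have commV g h : (g * h = h * g)%g -> (g * h^-1 = h^-1 * g)%g.
  move=> gh; apply: (mulgI h).
  by rewrite mulgA -gh mulgA mulgV mul1g -mulgA mulgV mulg1.
have e1 := near h1 h2 gh1 gh2 T1 T2.
have e2 := near h1^-1%g h2 (commV _ _ gh1) gh2.
have e3 := near h1 h2^-1%g gh1 (commV _ _ gh2).
have e4 := near h1^-1%g h2^-1%g (commV _ _ gh1) (commV _ _ gh2).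
rewrite !trace_inv in e2 e3 e4; have {}e2 := e2 T1 T2; have {}e3 := e3 T1 T2.
have {}e4 := e4 T1 T2.
have e5 := expanded_or_inverse t1 v0; have e6 := expanded_or_inverse t2 v0.
rewrite -!SL_invE in e5 e6.
have le2 h : stretch_weight R h v <= 2.
  by rewrite /stretch_weight; case: ifP => _; [lra | case: ifP => _; lra].
have half h : (vnrm v < vnrm (app h v))%N -> stretch_weight R h v = 2^-1.
  by rewrite /stretch_weight => ->.
have le52 h h' : (vnrm v < vnrm (app h v))%N || (vnrm v < vnrm (app h' v))%N ->
    stretch_weight R h v + stretch_weight R h' v <= 5 / 2.
  by move=> /orP[]/half ->; [have := le2 h' | have := le2 h]; lra.
case: (boolP (vnrm v < vnrm (app h1 v))%N) => [/half w1|/negPf n1]; last first.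
  rewrite n1 orFb in e1 e3; have := le52 _ _ e5; rewrite (half _ e1) (half _ e3).
  by move=> le5; rewrite addrC; exact: le_trans (lerD (lexx _) le5) num.
case: (boolP (vnrm v < vnrm (app h1^-1%g v))%N) => [/half w1'|/negPf n1];
  last first.
  rewrite n1 orFb in e2 e4; have := le52 _ _ e5; rewrite (half _ e2) (half _ e4).
  by move=> le5; rewrite addrC; exact: le_trans (lerD (lexx _) le5) num.
by rewrite w1 w1'; apply: le_trans (lerD (lexx _) (le52 _ _ e6)) num.
Qed.

Definition square_iter k g : G := iter k (fun x => x * x)%g g.

Lemma square_iter_comm k g : (g * square_iter k g = square_iter k g * g)%g.
Proof. by elim: k => //= k IH; rewrite mulgA IH -mulgA IH mulgA. Qed.

Lemma square_iter_trace k g : (1 < size (\tr g))%N ->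
  (k.+1 < nrm (\tr (square_iter k g)))%N.
Proof.
move=> tg; elim: k => [|k IH].
  by rewrite ltnNge; apply/negP => /(@size_le_nrm _ _ 0); rewrite leqNgt tg.
have t1 : (1 < nrm (\tr (square_iter k g)))%N by apply: leq_ltn_trans IH.
have -> : nrm (\tr (square_iter k.+1 g)) = (nrm (\tr (square_iter k g)) ^ 2)%N.
  exact: trace_square (det_SL _) t1.
by move: t1 IH; move: (nrm _) => N; nia.
Qed.

Lemma square_iter_words (S : seq G) k n g : g \in words S n ->
  square_iter k g \in words S (2 ^ k * n).
Proof.
move=> gn; elim: k => [|k IH]; first by rewrite mul1n.
by rewrite expnS -mulnA mul2n -addnn; apply: mem_words_mul.
Qed.

Lemma mx_bounded_exists g : exists K, mx_bounded g K.
Proof.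
exists (\max_i \max_j nrm (g i j)) => i j.
by apply: leq_trans (leq_bigmax i); apply: (leq_bigmax j).
Qed.

End Growth.

(** * Events *)

Section Probability.
Variables (R : realFieldType) (G : groupType) (S : seq G).
Hypothesis S_gt0 : (0 < size S)%N.
Implicit Types (P Q : pred G) (n m : nat).

Definition prob n P : R := expect S n (fun x => (P x)%:R).

Lemma prob_ge0 n P : 0 <= prob n P.
Proof. by apply: expect_ge0 => // x; rewrite ler0n. Qed.

Lemma prob_le1 n P : prob n P <= 1.
Proof. by apply: expect_le_cst => // x _; case: (P x). Qed.

Lemma le_prob n P Q : {in words S n, forall x, P x -> Q x} ->
  prob n P <= prob n Q.
Proof.
move=> PQ; apply: le_expect => // x /PQ; rewrite ler_nat.
by case: (P x) => // ->.
Qed.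

Lemma union_bound n P (I : finType) (Q : I -> pred G) :
  {in words S n, forall x, P x -> exists i, Q i x} ->
  prob n P <= \sum_i prob n (Q i).
Proof.
move=> PQ; rewrite -expect_sum; apply: le_expect => // x /PQ.
have ge0 (J : pred I) : 0 <= \sum_(i | J i) (Q i x)%:R :> R.
  by apply: sumr_ge0 => i _; rewrite ler0n.
case: (P x) => [/(_ isT)[i Qi]|_]; last exact: ge0.
by rewrite (bigD1 i) //= Qi lerDl ge0.
Qed.

Lemma prob_orb n P Q : prob n (fun x => P x || Q x) <= prob n P + prob n Q.
Proof.
rewrite -expectD; apply: le_expect => // x _; rewrite -natrD ler_nat.
by case: (P x) (Q x) => [] [].
Qed.

Lemma expect_pow4 n (phi : G -> R) : expect S n phi ^+ 4 =
  expect S n (fun x1 => expect S n (fun x2 => expect S n (fun x3 =>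
    expect S n (fun x4 => phi x1 * phi x2 * phi x3 * phi x4)))).
Proof.
set E := expect S n phi; symmetry.
transitivity (expect S n (fun x1 => phi x1 * E ^+ 3)); last first.
  by rewrite expectZr -exprS.
apply: eq_expect => x1 _.
transitivity (expect S n (fun x2 => phi x1 * phi x2 * E ^+ 2)); last first.
  by rewrite expectZr expectZ -mulrA -exprS.
apply: eq_expect => x2 _.
transitivity (expect S n (fun x3 => phi x1 * phi x2 * phi x3 * E)); last first.
  by rewrite expectZr expectZ -mulrA -expr2.
by apply: eq_expect => x3 _; rewrite expectZ.
Qed.

(** Two applications of the Cauchy-Schwarz inequality trade an event in two
    independent walks for many simultaneous conditions on one of them. *)
Lemma expect_four_copies n m (P : G -> pred G) :
  expect S n (fun x => prob m (P x)) ^+ 4 <=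
  expect S n (fun x1 => expect S n (fun x2 => expect S n (fun x3 =>
    expect S n (fun x4 => prob m (fun y =>
      [&& P x1 y, P x2 y, P x3 y & P x4 y]))))).
Proof.
rewrite [X in X ^+ 4]exchange_expect.
pose f y : R := expect S n (fun x => (P x y)%:R).
have f4 : expect S m f ^+ 4 <= expect S m (fun y => f y ^+ 4).
  rewrite (exprM _ 2 2).
  apply: (le_trans (y := expect S m (fun y => f y ^+ 2) ^+ 2)).
    rewrite lerXn2r ?nnegrE ?sqr_ge0 ?sqr_expect_le //.
    by apply: expect_ge0 => // y; exact: sqr_ge0.
  apply: le_trans (sqr_expect_le _ _ _) _ => //.
  by apply: le_expect => // y _; rewrite -exprM.
apply: le_trans f4 _; rewrite le_eqVlt; apply/orP; left; apply/eqP.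
transitivity (expect S m (fun y => expect S n (fun x1 => expect S n (fun x2 =>
  expect S n (fun x3 => expect S n (fun x4 =>
    [&& P x1 y, P x2 y, P x3 y & P x4 y]%:R : R)))))).
  apply: eq_expect => y _; rewrite expect_pow4.
  do 4 (apply: eq_expect => ? _); rewrite -!natrM !mulnb.
  by congr (nat_of_bool _)%:R; rewrite !andbA.
do 3 (rewrite exchange_expect; apply: eq_expect => ? _).
by rewrite exchange_expect.
Qed.

End Probability.

(** * Escape from centralizers *)

Section Escape.
Variables (R : realFieldType) (F : finFieldType) (S : seq (SL 2 {poly F})).
Local Notation D := {poly F}.
Local Notation G := (SL 2 {poly F}).
Hypothesis S_gt0 : (0 < size S)%N.
Variable b : nat -> R.
Hypothesis line_bound : forall n (u : D * D) (P : pred G), u != 0 ->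
  {in words S n &, forall x y, P x -> P y -> collinear u x y} ->
  prob R S n P <= b n.
Implicit Types (a g h x y z w : G) (n k : nat) (P : pred G).

Local Notation prob := (prob R S).

Lemma line_bound_ge0 n : 0 <= b n.
Proof.
apply: le_trans (line_bound (n := n) (P := pred0) (e1_neq0 _) _).
  exact: prob_ge0.
by [].
Qed.

Lemma point_bound n P : {in words S n &, forall x y, P x -> P y -> x = y} ->
  prob n P <= b n.
Proof.
move=> hP; apply: (line_bound (e1_neq0 _)) => x y xn yn Px Py.
by rewrite (hP x y) // collinear_refl.
Qed.

Lemma size_trace_const z : (size (\tr z) <= 1)%N -> exists c : F, \tr z = c%:P.
Proof. by move=> /size1_polyC ->; exists (\tr z)`_0. Qed.

(** In the field generated by [a] a trace determines an element up to
    inversion. *)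
Lemma trace_fibre n a g g' c : no_eigenline a ->
  prob n (fun w => (g * w * g' * a == a * (g * w * g'))%g &&
    (\tr (g * w * g')%g == c)) <= 2 * b n.
Proof.
move=> na; set P := fun w : G => _.
case: (pselect (exists2 w0, w0 \in words S n & P w0)) =>
  [[w0 _ /andP[/eqP c0 /eqP t0]]|none].
  have Psub w : P w -> (g * w * g' == g * w0 * g')%g ||
      (g * w * g' == (g * w0 * g')^-1)%g.
    move=> /andP[/eqP cw /eqP tw].
    have [e|e] := centralizer_trace na
      (det_SL (g * w * g')%g) (det_SL (g * w0 * g')%g)
      (congr1 (@SLval _ _) cw) (congr1 (@SLval _ _) c0) (etrans tw (esym t0)).
      by apply/orP; left; apply/eqP/SL_inj.
    by apply/orP; right; apply/eqP/SL_inj.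
  apply: (le_trans (le_prob R S_gt0 (Q := fun w => (g * w * g' == g * w0 * g')%g ||
    (g * w * g' == (g * w0 * g')^-1)%g) _)); first by move=> w _; exact: Psub.
  apply: le_trans (prob_orb _ _ _ _ _) _ => //; rewrite mulr_natl mulr2n lerD //.
    by apply: point_bound => x y _ _ /eqP <- /eqP /mulIg/mulgI.
  by apply: point_bound => x y _ _ /eqP <- /eqP /mulIg/mulgI.
apply: (le_trans (y := 0)); last by rewrite mulr_ge0 ?line_bound_ge0.
rewrite -(expect_cst S_gt0 n 0); apply: le_expect => // w wn.
by case: (boolP (P w)) => // Pw; case: none; exists w.
Qed.

(** The traces of [z z0] and [z z0^-1] have sum [tr z tr z0] and, by Fricke's
    identity, product [tr z ^ 2 + tr z0 ^ 2 - 4].  The sum forces one of them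
    to be as large as the bound for the product. *)
Lemma same_height_const z z0 : (z * z0 = z0 * z)%g ->
  size (\tr z) = size (\tr z0) ->
  (size (\tr (z * z0)%g) <= 1)%N || (size (\tr (z * z0^-1)%g) <= 1)%N.
Proof.
have arith i j k : (k * k <= maxn i j -> i * j <= maxn (k * k) 1 ->
    (i <= 1) || (j <= 1))%N.
  by nia.
move=> zz0 st; set A := \tr _; set B := \tr _.
have AB : A + B = \tr z * \tr z0.
  rewrite /A /B !SL_mulE SL_invE adj2E mulmxBr mul_mx_scalar raddfB /= mxtraceZ.
  by rewrite addrC subrK mulrC.
have prodAB : A * B = \tr z ^+ 2 + \tr z0 ^+ 2 - 4.
  have := fricke z z0; rewrite !det_SL -!SL_mulE zz0 subrr det0 -zz0 -/A => e.
  have -> : B = \tr z * \tr z0 - A by rewrite -AB addrC addKr.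
  by apply: (lincomb1 (-1) e); ring.
have nt : nrm (\tr z) = nrm (\tr z0) by rewrite /nrm -!size_poly_eq0 st.
pose N := nrm (\tr z0).
have sumN : (N * N <= maxn (nrm A) (nrm B))%N.
  rewrite /N -{1}nt -nrmM -AB; apply: nrmD_le; rewrite leq_max leqnn ?orbT //.
have prodN : (nrm A * nrm B <= maxn (N * N) 1)%N.
  rewrite -nrmM prodAB !expr2; apply: nrmB_le; last first.
    rewrite leq_max orbC -[4]/(4%:R) -polyC_natr; apply/orP; left.
    by apply: (nrm_le_size (n := 0)); exact: size_polyC_leq1.
  by rewrite leq_max; apply/orP; left; apply: nrmD_le; rewrite nrmM // nt.
suff : (nrm A <= 1)%N || (nrm B <= 1)%N.
  by move=> /orP[] /(@size_le_nrm _ _ 0) ->; rewrite ?orbT.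
exact: arith sumN prodN.
Qed.

(** Multiplying by a fixed element whose trace has the same degree, or by its
    inverse, leads to a constant trace, for which there are [#|F|] values. *)
Lemma height_fibre n a g k : no_eigenline a ->
  prob n (fun w => (g * w * a == a * (g * w))%g && (size (\tr (g * w)%g) == k))
    <= (4 * #|F|)%:R * b n.
Proof.
move=> na; set P := fun w : G => _.
case: (pselect (exists2 w0, w0 \in words S n & P w0)) =>
  [[w0 _ /andP[/eqP c0 /eqP t0]]|none]; last first.
  apply: (le_trans (y := 0)); last by rewrite mulr_ge0 ?line_bound_ge0 ?ler0n.
  rewrite -(expect_cst S_gt0 n 0); apply: le_expect => // w wn.
  by case: (boolP (P w)) => // Pw; case: none; exists w.
pose z0 := (g * w0)%g.
pose Q (i : bool * F) w := let g' := if i.1 then z0 else z0^-1%g in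
  (g * w * g' * a == a * (g * w * g'))%g && (\tr (g * w * g')%g == i.2%:P).
apply: (le_trans (union_bound R S_gt0 (Q := Q) _)).
  move=> w _ /andP[/eqP cw /eqP tw].
  have cz : (g * w * z0 = z0 * (g * w))%g.
    apply/SL_inj; apply: (centralizer_comm (no_eigenline_nonscalar na)).
      exact: (congr1 (@SLval _ _) cw).
    exact: (congr1 (@SLval _ _) c0).
  have ca g' : (g' * a = a * g' -> g * w * g' * a = a * (g * w * g'))%g.
    by move=> g'a; rewrite -mulgA g'a mulgA cw -mulgA.
  have /orP[] := same_height_const cz (etrans tw (esym t0)).
    move=> /size_trace_const[c tc]; exists (true, c).
    by rewrite /Q /= (ca _ c0) tc !eqxx.
  move=> /size_trace_const[c tc]; exists (false, c).
  rewrite /Q [(_, _).1]/= [(_, _).2]/= tc eqxx andbT; apply/eqP/ca.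
  by apply: (mulgI z0); rewrite !mulgA mulgV mul1g -/z0 c0 -mulgA mulgV mulg1.
apply: (le_trans (y := \sum_(i : bool * F) (2 * b n))).
  by apply: ler_sum => -[i c] _; exact: trace_fibre.
rewrite sumr_const card_prod card_bool -[X in X <= _]mulr_natr; rewrite !natrM.
rewrite le_eqVlt; apply/orP; left; apply/eqP; ring.
Qed.

(** If [a] fixes a line then so does its centralizer.  Otherwise one sums over
    the heights that words can reach. *)
Lemma centralizer_bound n a g k : SLval a != (a 0 0)%:M ->
  {in words S n, forall w, (size (\tr (g * w)%g) <= k)%N} ->
  prob n (fun w => (g * w * a == a * (g * w))%g) <= (k.+1 * (4 * #|F|))%:R * b n.
Proof.
move=> a_ns hk; case: (pselect (no_eigenline a)) => [na|].
  apply: (le_trans (union_bound R S_gt0 (Q := fun (i : 'I_k.+1) w =>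
    (g * w * a == a * (g * w))%g && (size (\tr (g * w)%g) == i)) _)).
    move=> w wn cw; exists (Ordinal (hk w wn : (_ < k.+1)%N)).
    by rewrite cw /= eqxx.
  apply: (le_trans (y := \sum_(i < k.+1) ((4 * #|F|)%:R * b n))).
    by apply: ler_sum => i _; exact: height_fibre.
  by rewrite sumr_const card_ord -[X in X <= _]mulr_natl mulrA -natrM.
move=> /existsNP[v /not_implyP[va /eqP v0]].
apply: (le_trans (y := b n)).
  apply: (line_bound v0) => x y _ _ /eqP cx /eqP cy; rewrite /collinear.
  have fixes z : (z * a = a * z)%g -> wedge v (app z v) = 0.
    move=> za; apply: (eigenline_centralizer a_ns) => //.
    exact: (congr1 (@SLval _ _) za).
  rewrite -(wedge_SL g) -!app_SLM; apply/eqP; apply: (wedge_trans v0).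
    by rewrite wedgeC fixes ?oppr0.
  exact: fixes.
rewrite -[X in X <= _]mul1r ler_wpM2r ?line_bound_ge0 //.
rewrite ler1n muln_gt0 /= muln_gt0 /=.
by apply/card_gt0P; exists 0.
Qed.

End Escape.

(** * Escape from linear conditions *)

Section Traces.
Variables (R : realFieldType) (F : finFieldType) (S : seq (SL 2 {poly F})).
Local Notation D := {poly F}.
Local Notation G := (SL 2 {poly F}).
Hypothesis S_gt0 : (0 < size S)%N.
Hypothesis S_inv : {in S, forall s, s^-1%g \in S}.
Variable b : nat -> R.
Hypothesis line_bound : forall n (u : D * D) (P : pred G), u != 0 ->
  {in words S n &, forall x y, P x -> P y -> collinear u x y} ->
  prob R S n P <= b n.
Implicit Types (g h x y z w : G) (n k : nat) (P : pred G) (m : 'M[D]_2).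

Local Notation prob := (prob R S).
Local Notation expect := (expect S).

Lemma mx_bounded_mul (g h : 'M[D]_2) K L : mx_bounded g K -> mx_bounded h L ->
  mx_bounded (g *m h) (K * L).
Proof.
by move=> gK hL i j; rewrite mulmx2E; apply: nrmD_le; apply: nrmM_le.
Qed.

Lemma words_bounded : exists d, forall n w, w \in words S n ->
  mx_bounded w (2 ^ (d * n)).
Proof.
have [d hd] : exists d, forall s, s \in S -> mx_bounded s (2 ^ d).
  elim: S => [|s S' [d hd]]; first by exists 0%N.
  have [K sK] := mx_bounded_exists s; exists (d + K)%N => t.
  rewrite inE => /orP[/eqP ->|/hd td] i j.
    apply: leq_trans (sK i j) _.
    apply: leq_trans (ltnW (ltn_expl K (isT : (1 < 2)%N))) _.
    by rewrite leq_exp2l // leq_addl.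
  by apply: leq_trans (td i j) _; rewrite leq_exp2l // leq_addr.
exists d; elim=> [|n IH] w.
  rewrite inE => /eqP -> i j; rewrite mxE; case: (i == j); rewrite ?mulr0n ?nrm0 //.
  by rewrite mulr1n; apply: nrm_le_size; rewrite size_poly1.
move=> /allpairsP[[s x] /= [sS xn ->]].
by rewrite mulnS expnD; apply: mx_bounded_mul; [apply: hd | apply: IH].
Qed.

Lemma words_trace_size : exists d, forall n x y,
  x \in words S n -> y \in words S n ->
  (size (\tr (x^-1 * y)%g) <= (d * n).+1)%N.
Proof.
have [d hd] := words_bounded; exists d.*2 => n x y xn yn.
have := hd _ _ (mem_words_mul (mem_words_inv S_inv xn) yn) => xyb.
apply: size_le_nrm; rewrite mxtrace2E -doubleMl doubleMr -addnn.
by apply: nrmD_le; apply: xyb.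
Qed.

(** Linear dependence over the fraction field, expressed by the dimension of the
    orthogonal space, which is the form in which it is used. *)
Definition dependent3 x y z := `[< exists m m', ~ parallel m m' /\
  [/\ \tr (x *m m) = 0, \tr (y *m m) = 0 & \tr (z *m m) = 0] /\
  [/\ \tr (x *m m') = 0, \tr (y *m m') = 0 & \tr (z *m m') = 0] >].

Lemma dependent3_comm x y z : dependent3 x y z ->
  (x^-1 * z * (x^-1 * y) = x^-1 * y * (x^-1 * z))%g.
Proof.
move=> /asboolP[m [m' [mm' [[t1 t2 t3] [t4 t5 t6]]]]]; apply: SL_inj.
have e w : x *m (x^-1 * w)%g = w by rewrite -SL_mulE mulgA mulgV mul1g.
by symmetry; apply: (orth_plane_comm (x := x)) mm' _ _ _ _ _ _; rewrite ?e // det_SL.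
Qed.

Lemma scalar_bound n x :
  prob n (fun y => SLval (x^-1 * y)%g == ((x^-1 * y)%g 0 0)%:M) <= b n.
Proof.
apply: (line_bound (e1_neq0 _)) => y z _ _ /eqP yn /eqP zn.
have scal w : SLval (x^-1 * w)%g = ((x^-1 * w)%g 0 0)%:M ->
    wedge (1, 0) (app (x^-1 * w)%g (1, 0)) = 0 :> D.
  by move=> ->; rewrite /wedge /app /= !mxE ?mulr1n ?mulr0n; ring.
rewrite /collinear -(wedge_SL x^-1%g) -!app_SLM; apply/eqP.
apply: (wedge_trans (e1_neq0 _)); last exact: scal.
by rewrite wedgeC scal ?oppr0.
Qed.

Lemma dependent3_bound : exists d, forall n,
  expect n (fun x => expect n (fun y => prob n (dependent3 x y))) <=
  b n + ((d * n).+2 * (4 * #|F|))%:R * b n.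
Proof.
have [d hd] := words_trace_size; exists d => n.
apply: expect_le_cst => // x xn.
set c := (_%:R * b n).
apply: (le_trans (y := expect n (fun y =>
    (SLval (x^-1 * y)%g == ((x^-1 * y)%g 0 0)%:M)%:R + c))); last first.
  by rewrite expectD expect_cst // lerD2r; exact: scalar_bound.
apply: le_expect => // y yn.
case: (boolP (_ == _)) => [_|y_ns] /=.
  apply: le_trans (prob_le1 _ S_gt0 _ _) _; rewrite lerDl /c.
  by rewrite mulr_ge0 // (line_bound_ge0 S_gt0 line_bound).
rewrite add0r; apply: (le_trans (y := prob n (fun z =>
    (x^-1 * z * (x^-1 * y) == x^-1 * y * (x^-1 * z))%g))).
  by apply: le_prob => // z _ /dependent3_comm /eqP.
rewrite /c.
apply: (centralizer_bound (k := (d * n).+1) S_gt0 line_bound y_ns) => w wn.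
exact: hd.
Qed.

(** A bound on hyperplane probabilities that is uniform in the hyperplane is
    inherited by longer walks. *)
Lemma trace_longer n k (c : R) (t : D) (E : 'M[D]_2 -> Prop) :
  (forall m y, E m -> E (y *m m)) ->
  (forall m, E m -> prob n (fun w => \tr (w *m m) == t) <= c) ->
  forall m, E m -> prob (n + k) (fun w => \tr (w *m m) == t) <= c.
Proof.
move=> EM hc m Em; rewrite /prob expect_add exchange_expect.
apply: expect_le_cst => // y _; apply: le_trans (hc (y *m m) (EM _ _ Em)).
by apply: le_expect => // x _; rewrite SL_mulE mulmxA.
Qed.

Lemma mul_SL_neq0 y m : m != 0 -> y *m m != 0.
Proof.
apply: contraNneq => ym; apply/eqP; apply: (mulmx_det_eq0 _ ym).
by rewrite det_SL oner_eq0.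
Qed.

(** A singular [m] confines the image of one of its columns to a line. *)
Lemma singular_trace_bound n m : m != 0 -> \det m = 0 ->
  prob n (fun w => \tr (w *m m) == 0) <= b n.
Proof.
move=> /mx2_neq0[i [j mij]] dm.
have r0 : (- m i 1, m i 0) != 0.
  by apply: vecN_neq0; move: mij; move: (j); apply: ord2P => ->; rewrite ?orbT.
have u0 : (m 0 j, m 1 j) != 0 :> D * D.
  apply: contraNneq mij => -[m0j m1j]; apply/eqP.
  by move: (i); apply: ord2P.
apply: (line_bound u0) => x y _ _ /eqP tx /eqP ty; apply/eqP.
apply: (wedge_trans r0); last exact: singular_trace.
by rewrite wedgeC singular_trace ?oppr0.
Qed.

Lemma parallel_col0 (m m' : 'M[D]_2) : parallel m m' ->
  wedge (m 0 0, m 1 0) (m' 0 0, m' 1 0) = 0.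
Proof. by move=> mm'; rewrite /wedge /= (mm' 0 0 1 0) subrr. Qed.

Lemma parallel_SL_collinear x y m : \det m != 0 -> parallel (x *m m) (y *m m) ->
  collinear (1, 0) x y.
Proof.
move=> dm /(@parallel_mulr _ _ _ (\adj m)).
rewrite -!mulmxA !mul_mx_adj !mul_mx_scalar.
move: (\det m) dm => d d0 xy; have {}xy : parallel x y.
  move=> i j k l; have := xy i j k l.
  rewrite [in LHS]mxE [in LHS]mxE [in RHS]mxE [in RHS]mxE.
  by rewrite [in LHS]mulrACA [in RHS]mulrACA; apply: mulfI; rewrite mulf_neq0.
have := parallel_col0 xy; rewrite /collinear /app /= => e.
by apply/eqP; rewrite -[RHS]e /wedge /=; ring.
Qed.

(** If [m] is nonsingular and x_1, x_2, x_3 are linearly independent, the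
    equations [tr (x_i y m) = 0] determine [y m] up to a factor, hence the line
    to which [y] sends a given vector. *)
Lemma hyperplane_bound n m (r : R) : m != 0 ->
  expect n (fun x => expect n (fun y => prob n (dependent3 x y))) + b n <= r ^+ 4 ->
  0 <= r -> prob (n + n) (fun w => \tr (w *m m) == 0) <= b n + r.
Proof.
move=> m0 hr r0; have b0 := line_bound_ge0 S_gt0 line_bound n.
have [dm|dm] := eqVneq (\det m) 0.
  apply: (@trace_longer n n _ _ (fun m => m != 0 /\ \det m = 0)) => //.
  - move=> m1 y [m10 dm1]; split; first exact: mul_SL_neq0.
    by rewrite det_mulmx dm1 mulr0.
  - move=> m1 [m10 dm1]; apply: le_trans (singular_trace_bound _ m10 dm1) _.
    by rewrite lerDl.
apply: (le_trans (y := r)); last by rewrite lerDr.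
rewrite -(ler_pXn2r (isT : (0 < 4)%N)) ?nnegrE ?prob_ge0 //; apply: le_trans hr.
rewrite {1}/prob expect_add.
apply: le_trans (expect_four_copies _ S_gt0 _ _ _) _.
rewrite -[b n](expect_cst S_gt0 n) -expectD; apply: le_expect => // x1 _.
rewrite -[b n](expect_cst S_gt0 n) -expectD; apply: le_expect => // x2 _.
rewrite -[b n](expect_cst S_gt0 n) -expectD; apply: le_expect => // x3 _.
apply: expect_le_cst => // x4 _.
case: (boolP (dependent3 x1 x2 x3)) => [_|/asboolPn dep].
  by apply: le_trans (prob_le1 _ S_gt0 _ _) _; rewrite lerDl.
rewrite add0r; apply: (line_bound (e1_neq0 _)) => y z _ _.
move=> /and4P[/eqP y1 /eqP y2 /eqP y3 _] /and4P[/eqP z1 /eqP z2 /eqP z3 _].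
apply: (parallel_SL_collinear dm); apply: contrapT => npar; apply: dep.
by exists (y *m m), (z *m m); split=> //; rewrite !mulmxA.
Qed.

Definition dependent4 x1 x2 x3 x4 := `[< exists2 m, m != 0 &
  [/\ \tr (x1 *m m) = 0, \tr (x2 *m m) = 0, \tr (x3 *m m) = 0 &
    \tr (x4 *m m) = 0] >].

(** The first three copies determine [m] up to a factor, so the fourth satisfies
    a fixed linear equation. *)
Lemma dependent4_bound n x1 x2 x3 (c : R) :
  (forall m, m != 0 -> prob n (fun w => \tr (w *m m) == 0) <= c) -> 0 <= c ->
  prob n (fun x4 => ~~ dependent3 x1 x2 x3 && dependent4 x1 x2 x3 x4) <= c.
Proof.
move=> hc c0; case: (boolP (dependent3 x1 x2 x3)) => [_|/asboolPn dep] /=.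
  by rewrite /prob expect_cst.
case: (pselect (exists2 m, m != 0 &
    [/\ \tr (x1 *m m) = 0, \tr (x2 *m m) = 0 & \tr (x3 *m m) = 0])).
  move=> [m m0 [t1 t2 t3]]; apply: le_trans (hc m m0).
  apply: le_prob => // x4 _ /asboolP[m' m'0 [s1 s2 s3 s4]].
  have mm' : parallel m' m by apply: contrapT => npar; apply: dep; exists m', m.
  have [k [l [mkl e]]] := parallel_scale mm' m'0.
  apply/eqP/(mulfI mkl).
  by rewrite mulr0 -mxtraceZ scalemxAr e -scalemxAr mxtraceZ s4 mulr0.
move=> none; apply: le_trans c0; rewrite -(expect_cst S_gt0 n 0).
apply: le_expect => // x4 _.
case: (boolP (dependent4 _ _ _ _)) => // /asboolP[m m0 [s1 s2 s3 s4]].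
by case: none; exists m.
Qed.

(** For linearly independent x_i the differences of two solutions of
    [tr (x_i y) = t] vanish. *)
Lemma trace_bound n (c r : R) (t : D) y :
  (forall m, m != 0 -> prob n (fun w => \tr (w *m m) == 0) <= c) -> 0 <= c ->
  expect n (fun x => expect n (fun y => prob n (dependent3 x y))) + c + b n <= r ^+ 4 ->
  0 <= r -> prob (n + n) (fun w => \tr (w *m y) == t) <= r.
Proof.
move=> hc c0 hr r0; have b0 := line_bound_ge0 S_gt0 line_bound n.
rewrite -(ler_pXn2r (isT : (0 < 4)%N)) ?nnegrE ?prob_ge0 //; apply: le_trans hr.
rewrite {1}/prob expect_add.
apply: le_trans (expect_four_copies _ S_gt0 _ _ _) _.
rewrite -addrA.
rewrite -[c + b n](expect_cst S_gt0 n) -expectD; apply: le_expect => // x1 _.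
rewrite -[c + b n](expect_cst S_gt0 n) -expectD; apply: le_expect => // x2 _.
rewrite -[c + b n](expect_cst S_gt0 n) -expectD; apply: le_expect => // x3 _.
apply: (le_trans (y := expect n (fun x4 => (dependent3 x1 x2 x3)%:R +
  ((~~ dependent3 x1 x2 x3 && dependent4 x1 x2 x3 x4)%:R + b n)))); last first.
  rewrite !expectD !expect_cst // lerD2l lerD2r; exact: dependent4_bound.
apply: le_expect => // x4 _.
case: (boolP (dependent3 x1 x2 x3)) => [_|_] /=.
  by apply: le_trans (prob_le1 _ S_gt0 _ _) _; rewrite add0r lerDl.
case: (boolP (dependent4 x1 x2 x3 x4)) => [_|/asboolPn dep] /=.
  by apply: le_trans (prob_le1 _ S_gt0 _ _) _; rewrite add0r lerDl.
rewrite !add0r; apply: (point_bound line_bound) => z z' _ _.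
move=> /and4P[/eqP y1 /eqP y2 /eqP y3 /eqP y4] /and4P[/eqP z1 /eqP z2 /eqP z3 /eqP z4].
apply: contrapT => zz'; apply: dep; exists ((SLval z - SLval z') *m y).
  apply: contra_notN zz' => /eqP e; apply/SL_inj/subr0_eq.
  rewrite -[LHS]mulmx1 -[1%:M]/(SLval 1%g) -(mulgV y) SL_mulE mulmxA e.
  exact: mul0mx.
by split; rewrite mulmxA mulmxBr mulmxBl raddfB /= ?y1 ?y2 ?y3 ?y4
  ?z1 ?z2 ?z3 ?z4 subrr.
Qed.

End Traces.

(** * Constant traces are rare *)

Section Main.
Variables (R : realFieldType) (F : finFieldType) (S : seq (SL 2 {poly F})).
Local Notation D := {poly F}.
Local Notation G := (SL 2 {poly F}).
Hypothesis S_gt0 : (0 < size S)%N.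
Hypothesis S_uniq : uniq S.
Hypothesis S_inv : {in S, forall s, s^-1%g \in S}.
Hypothesis S_nonelem : non_elementary (generated [set` S]).

Lemma collision_decay : exists2 b, exp_small b &
  forall n (u : D * D), u != 0 -> collision R S n u <= b n.
Proof.
have pad N i j : ((2 ^ N * j).+1.*2 + 2 ^ N.+1 * i =
    (2 ^ N * (i + j)).+1 + (2 ^ N * (i + j)).+1)%N.
  by rewrite expnS -addnn mulnDr -mulnA; lia.
have [g1 [g2 [g1S g2S t1 t2 dC]]] :=
  hyperbolic_pair (generated_subgroup _) S_nonelem.
have [n1 w1] := generated_words S_inv g1S.
have [n2 w2] := generated_words S_inv g2S.
have [K1 bK1] := mx_bounded_exists g1; have [K2 bK2] := mx_bounded_exists g2.
pose K := (K1 + K2)%N.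
have bd1 : mx_bounded g1 K.
  by move=> i j; apply: leq_trans (bK1 i j) (leq_addr _ _).
have bd2 : mx_bounded g2 K.
  by move=> i j; apply: leq_trans (bK2 i j) (leq_addl _ _).
have T1 := square_iter_trace (K ^ 4)%N.+1 t1.
have T2 := square_iter_trace (K ^ 4)%N.+1 t2.
set h1 := square_iter _ g1 in T1; set h2 := square_iter _ g2 in T2.
(* both powers have even word length, as at least one squaring takes place,
   so they can be padded to the common length [m + m] *)
pose m := (2 ^ (K ^ 4) * (n1 + n2))%N.+1.
have h1m : h1 \in words S (m + m).
  have := mem_words_pad S_gt0 S_inv (2 ^ (K ^ 4) * n2)%N.+1
    (square_iter_words (K ^ 4)%N.+1 w1).
  by rewrite pad.
have h2m : h2 \in words S (m + m).
  have := mem_words_pad S_gt0 S_inv (2 ^ (K ^ 4) * n1)%N.+1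
    (square_iter_words (K ^ 4)%N.+1 w2).
  by rewrite pad /m (addnC n1).
apply: (collision_small S_gt0 S_uniq S_inv (m := m) _ h1m h2m) => // v v0.
apply: (stretch_weights _ dC bd1 bd2) => //; try exact: square_iter_comm; lia.
Qed.

Lemma constant_trace_decay : exists2 b, exp_small b &
  forall n, prob R S n (fun w => (size (\tr w) <= 1)%N) <= b n.
Proof.
have [bc bc_small bcP] := collision_decay.
have [b b_small bP] := exp_small_root (isT : (0 < 2)%N) bc_small.
have line_bound n (u : D * D) (P : pred G) : u != 0 ->
    {in words S n &, forall x y, P x -> P y -> collinear u x y} ->
    prob R S n P <= b n.
  move=> u0 hP; have [b0 bb] := bP n.
  rewrite -(ler_pXn2r (isT : (0 < 2)%N)) ?nnegrE ?prob_ge0 //.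
  by apply: le_trans (one_line_le _ S_gt0 hP) (le_trans (bcP _ _ u0) bb).
have [d hd] := dependent3_bound S_gt0 S_inv line_bound.
pose b3 n := b n + ((d * n).+2 * (4 * #|F|))%:R * b n.
have b3_small : exp_small b3.
  apply: exp_smallD => //.
  apply: (exp_small_le (b' := fun n =>
    (d * (4 * #|F|))%:R * (n%:R * b n) + (8 * #|F|)%:R * b n)).
    by apply: exp_smallD; apply: exp_smallZ => //; exact: exp_small_linear.
  move=> n; rewrite mulrA -natrM -mulrDl -natrD le_eqVlt.
  apply/orP; left; apply/eqP.
  by congr (_%:R * _); lia.
have b0 n : 0 <= b n := (bP n).1.
have [r1 r1_small r1P] :=
  exp_small_root (isT : (0 < 4)%N) (exp_smallD b3_small b_small).
pose c n := b (n %/ 2)%N + r1 (n %/ 2)%N.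
have c0 n : 0 <= c n by rewrite addr_ge0 ?b0 ?(r1P _).1.
have c_small : exp_small c.
  by apply: exp_smallD; apply: (exp_small_div (k := 2)).
have split2 n : (n = n %/ 2 + n %/ 2 + n %% 2)%N.
  by rewrite addnn -muln2 -divn_eq.
have hyper n m : m != 0 -> prob R S n (fun w => \tr (w *m m) == 0) <= c n.
  move=> m0; rewrite {1}(split2 n).
  apply: (@trace_longer _ _ _ S_gt0 _ _ _ _ (fun m => m != 0)) m0 => [m' y|m' m'0].
    exact: mul_SL_neq0.
  apply: (hyperplane_bound S_gt0 line_bound) => //; last exact: (r1P _).1.
  by apply: le_trans (r1P _).2; rewrite lerD2r; exact: hd.
have [r2 r2_small r2P] := exp_small_root (isT : (0 < 4)%N)
  (exp_smallD (exp_smallD b3_small c_small) b_small).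
have tr_eq n t : prob R S n (fun w => \tr w == t) <= r2 (n %/ 2)%N.
  apply: (le_trans (y := prob R S n (fun w => \tr (w *m (1%g : G)) == t))).
    by apply: le_prob => // w _; rewrite mulmx1.
  rewrite {1}(split2 n).
  apply: (@trace_longer _ _ _ S_gt0 _ _ _ _ (fun m => exists y : G, m = y));
    last by exists 1%g.
    by move=> _ y [z ->]; exists (y * z)%g.
  move=> _ [y ->].
  apply: (trace_bound S_gt0 line_bound t y (hyper _)) => //; last exact: (r2P _).1.
  by apply: le_trans (r2P _).2; rewrite !lerD2r; exact: hd.
exists (fun n => #|F|%:R * r2 (n %/ 2)%N).
  by apply: exp_smallZ => //; apply: (exp_small_div (k := 2)).
move=> n; apply: (le_trans (union_bound R S_gt0
  (Q := fun (a : F) w => \tr w == a%:P) _)).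
  by move=> w _ /size_trace_const[a ->]; exists a.
apply: (le_trans (ler_sum _ (fun a _ => tr_eq n a%:P))).
by rewrite sumr_const -[X in X <= _]mulr_natl.
Qed.

End Main.

(** * Reducible characteristic polynomials *)

Section CharPoly.
Variable F : fieldType.

Lemma char_poly2E (D : comNzRingType) (g : 'M[D]_2) :
  char_poly g = 'X ^+ 2 - (\tr g)%:P * 'X + (\det g)%:P.
Proof.
rewrite /char_poly /char_poly_mx !det2E mxtrace2E !submx2E !mxE ?mulr1n ?mulr0n.
rewrite !(polyCD, polyCN, polyCM).
by ring.
Qed.

(** The factors of a reducible characteristic polynomial are linear with unit
    leading coefficients, so there is a root x in the polynomial ring, and
    x (tr g - x) = 1 makes both x and tr g - x constant. *)
Lemma reducible_constant_trace (g : SL 2 {poly F}) :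
  reducible (char_poly g) -> (size (\tr g) <= 1)%N.
Proof.
move=> [f0 [q [r [qU rU fqr]]]].
have [q0 r0] : q != 0 /\ r != 0.
  by move: f0; rewrite fqr mulf_eq0 negb_or => /andP[].
have lqr : lead_coef q * lead_coef r = 1.
  by rewrite -lead_coefM -fqr; apply/monicP/char_poly_monic.
have lqU : lead_coef q \is a GRing.unit by apply/unitrPr; exists (lead_coef r).
have lrU : lead_coef r \is a GRing.unit.
  by apply/unitrPr; exists (lead_coef q); rewrite mulrC.
have nonconst (s : {poly {poly F}}) : s != 0 -> s \isn't a GRing.unit ->
    lead_coef s \is a GRing.unit -> (1 < size s)%N.
  move=> s0 sU lU; rewrite ltnNge; apply: contra sU => s1.
  move: lU; rewrite (size1_polyC s1) lead_coefC => lU.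
  rewrite poly_unitE coefC /= lU size_polyC andbT.
  by have -> : s`_0 != 0 by apply: contraTneq lU => ->; rewrite unitr0.
have sq := nonconst q q0 qU lqU; have sr := nonconst r r0 rU lrU.
have : size (q * r) = 3%N by rewrite -fqr size_char_poly.
rewrite size_mul // => sqr; have {sqr}sq2 : size q = 2%N.
  by move: sq sr sqr; move: (size q) (size r) => i j; lia.
have [x qx] : exists x, q.[x] = 0.
  exists (- q`_0 / q`_1).
  rewrite horner_coef sq2 !big_ord_recl big_ord0 /= expr0 expr1 mulr1 addr0.
  by rewrite mulrCA divrr ?mulr1 ?subrr //; move: lqU; rewrite lead_coefE sq2.
have /= fx : (char_poly g).[x] = 0 by rewrite fqr hornerM qx mul0r.
rewrite char_poly2E det_SL !hornerE in fx.
have xU : x * (\tr g - x) = 1 by apply: (lincomb1 (-1) fx); ring.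
have const (y z : {poly F}) : y * z = 1 -> (size y <= 1)%N.
  move=> yz; have : y \is a GRing.unit by apply/unitrPr; exists z.
  by rewrite poly_unitE => /andP[/eqP ->].
rewrite -[\tr g](subrK x) (leq_trans (size_polyD _ _)) // geq_max.
by rewrite (const _ _ xU) (const _ x) // mulrC.
Qed.
End CharPoly.

(** * Convolution powers as averages over words *)

Section Mass.
Variables (R : realType) (G : groupType) (S : {fset G}).
Hypothesis S_gt0 : (0 < size S)%N.

Lemma fsbig_expect l (A : set G) (psi : G -> R) :
  \sum_(h \in A) expect S l (fun w => (w == h)%:R) * psi h =
  expect S l (fun w => \1_A w * psi w).
Proof.
rewrite -[A in LHS]set_mem_set.
rewrite -(@bigfs _ _ _ _ (undup (words S l))) ?undup_uniq //; last first.
  move=> h _; rewrite mem_undup => hl; rewrite -[X in X * _](_ : 0 = _) ?mul0r //.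
  rewrite -(expect_cst S_gt0 l 0); apply: eq_expect => w wl.
  by case: eqP => // wh; rewrite -wh wl in hl.
under eq_bigr do rewrite -expectZr.
rewrite -expect_sum; apply: eq_expect => w wl.
rewrite big_mkcond (bigD1_seq w) ?undup_uniq ?mem_undup //= eqxx indicE big1.
  have -> : in_set A w = (w \in A) by [].
  by rewrite addr0; case: (w \in A); rewrite ?mul1r ?mul0r.
by move=> h hw; rewrite eq_sym (negPf hw) mul0r; case: ifP.
Qed.

Lemma convolution_power_expect l g :
  convolution_power (uniform_measure R S) l g = expect S l (fun w => (w == g)%:R).
Proof.
elim: l g => [|l IH] g.
  by rewrite expect0 /convolution_power /= indicE in_set1 eq_sym.
rewrite /convolution_power iterS -/(convolution_power _ l) /convolution.
under eq_fsbigr do rewrite IH.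
rewrite fsbig_expect -addn1 expect_add; apply: eq_expect => w _.
rewrite indicT mul1r expect1 /uniform_measure indicE mulrC; congr (_ / _).
have -> : (w^-1 * g \in [set` S])%g = (w^-1 * g \in S)%g.
  by apply/idP/idP; rewrite inE.
have eqS s : (w * s == g)%g = (s == w^-1 * g)%g.
  by apply/eqP/eqP => [<-|->]; rewrite ?mulKg ?mulVKg.
under eq_bigr do rewrite eqS.
case: (boolP (w^-1 * g \in S)%g) => gS.
  rewrite (bigD1_seq _ gS) ?fset_uniq //= eqxx big1 ?addr0 // => s /negPf -> //.
by rewrite big_seq big1 // => s sS; case: eqP => // sg; rewrite -sg sS in gS.
Qed.

Lemma mass_expect l (X : set G) :
  mass (convolution_power (uniform_measure R S) l) X =
    prob R S l (fun g => g \in X).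
Proof.
transitivity (\sum_(h \in X) (expect S l (fun w => (w == h)%:R) * 1 : R)).
  by apply: eq_fsbigr => h _; rewrite convolution_power_expect mulr1.
by rewrite (fsbig_expect _ _ (fun=> 1)); apply: eq_expect => w _; rewrite mulr1 indicE.
Qed.
End Mass.

(** * From exponential to stretched exponential decay *)

(** For l >= 2, the square root of l / ln l is at most a constant times l. *)
Lemma exp_small_stretched (R : realType) (b : nat -> R) : exp_small b ->
  exists C1 C2 : R, [/\ 0 < C1, 0 < C2 & forall l, (2 <= l)%N ->
    b l <= C1 * expR (- C2 * Num.sqrt (l%:R / ln l%:R))].
Proof.
move=> [C [t [C1 t0 t1 bt]]].
have C0 : 0 < C by lra.
have ln2 : 0 < ln 2 :> R by rewrite ln_gt0 // ltr1n.
have lnt : 0 < - ln t by rewrite oppr_gt0 ln_lt0 // t0.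
pose a : R := Num.sqrt (ln 2)^-1.
have a0 : 0 < a by rewrite sqrtr_gt0 invr_gt0.
exists C, (- ln t / a); split=> //; first by rewrite divr_gt0.
move=> l l2; apply: le_trans (bt l) _; rewrite ler_wpM2l ?(ltW C0) //.
have -> : t ^+ l = expR (ln t * l%:R) by rewrite mulrC expRM_natl lnK.
rewrite ler_expR.
have l0 : 0 < l%:R :> R by rewrite ltr0n; lia.
have sq : Num.sqrt (l%:R / ln l%:R) <= a * l%:R :> R.
  have -> : a * l%:R = Num.sqrt ((ln 2)^-1 * l%:R ^+ 2) :> R.
    by rewrite sqrtrM ?invr_ge0 ?(ltW ln2) // sqrtr_sqr ger0_norm ?ler0n.
  rewrite ler_wsqrtr // mulrC.
  apply: ler_pM; rewrite ?ler0n ?invr_ge0 ?ln_ge0 ?ler1n //; first lia.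
    by rewrite lef_pV2 ?posrE ?ler_ln ?posrE ?ler_nat // ln_gt0 // ltr1n.
  by rewrite expr2 ler_peMl ?ler0n // ler1n; lia.
have : - ln t / a * Num.sqrt (l%:R / ln l%:R) <= - ln t / a * (a * l%:R).
  by rewrite ler_wpM2l // ltW // divr_gt0.
rewrite mulrA divfK ?gt_eqF //; lra.
Qed.

Theorem theorem1p4 (R : realType) (p : nat) (p_prime : prime p)
    (p_ge3 : (3 <= p)%N) (S : {fset (SL 2 {poly 'F_p})})
    (S_symmetric : symmetric_set [set` S])
    (S_non_elementary : non_elementary (generated [set` S])) :
  exists C1 C2 : R, [/\ 0 < C1, 0 < C2 &
    forall l : nat, (2 <= l)%N ->
      mass (convolution_power (uniform_measure R S) l)
           [set g : SL 2 {poly 'F_p} | reducible (char_poly g)]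
      <= C1 * expR (- C2 * Num.sqrt (l%:R / ln l%:R))].
Proof.
have S_inv : {in S, forall s, s^-1%g \in S}.
  move=> s sS; suff : [set` S] s^-1%g by [].
  by rewrite S_symmetric; exists s.
have S_gt0 : (0 < size S)%N.
  (* the empty set generates the trivial group *)
  rewrite lt0n; apply/eqP => S0; apply: S_non_elementary.
  apply: virtually_soluble_finite; first exact: generated_subgroup.
  apply: sub_finite_set (finite_set1 1%g).
  apply: generated_sub; first exact: subgroup1.
  by move=> s /= sS; have : s \in enum_fset S by []; rewrite (size0nil S0).
have [b b_small hb] := @constant_trace_decay R _ S S_gt0 (fset_uniq S) S_inv
  S_non_elementary.
have [C1 [C2 [C10 C20 hC]]] := exp_small_stretched b_small.
exists C1, C2; split=> // l l2; apply: le_trans (hC l l2); apply: le_trans (hb l).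
rewrite mass_expect //; apply: le_prob => // g _; rewrite inE.
exact: reducible_constant_trace.
Qed.
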